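(* Let $\alpha$ be a real constant with $0\le\alpha<1$ and let $a,b,c$ be complex numbers with $ab\neq0$ and $c\neq0,-1,-2,\dots$. Then the shifted hypergeometric function $z\,{}_2F_1(a,b;c;z)$ is starlike of order $\alpha$ if the following conditions are satisfied: (i) $p=a+b+1-c$ is a real number; (ii) $\operatorname{Re}[ab]>p(1-\alpha)$; (iii) $L\ge0$, $N\ge0$ and $LN-M^2\ge0$, where $$L=\frac{\operatorname{Re}[ab]}{1-\alpha}+p(1-2\alpha)-|a|^2-|b|^2+|c-1|^2-4\operatorname{Im}[a]\operatorname{Im}[b],$$ $$M=\frac{\operatorname{Im}[ab(\bar a+\bar b-2+2\alpha)]}{1-\alpha},$$ $$N=\frac{\operatorname{Re}[ab]}{1-\alpha}+p(1-2\alpha)-|a|^2-|b|^2+|c-1|^2-\left(2\operatorname{Re}[a]-\frac{|a|^2}{1-\alpha}\right)\left(2\operatorname{Re}[b]-\frac{|b|^2}{1-\alpha}\right).$$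
   Context: $\mathbb{D}=\{z\in\mathbb{C}:|z|<1\}$. For $c\neq0,-1,-2,\dots$, the hypergeometric function is ${}_2F_1(a,b;c;z)=\sum_{n=0}^\infty\frac{(a)_n(b)_n}{(c)_n\,n!}z^n$ for $|z|<1$, where $(a)_0=1$ and $(a)_n=a(a+1)\cdots(a+n-1)$ for $n\ge1$. An analytic function $f$ on $\mathbb{D}$ with $f(0)=f'(0)-1=0$ is called starlike of order $\alpha$ ($0\le\alpha<1$) if $\operatorname{Re}\frac{zf'(z)}{f(z)}>\alpha$ for all $z\in\mathbb{D}$ (where $zf'(z)/f(z)$ takes the value $1$ at $z=0$). *)

(* Defs.v *)
From Stdlib Require Export Reals Factorial.
From Coquelicot Require Export Coquelicot.

Open Scope R_scope.

(** Rising factorial [(a)_n = a (a + 1) ... (a + n - 1)]. *)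
Fixpoint pochhammer (a : C) (n : nat) : C :=
  match n with
  | O => RtoC 1
  | S m => (pochhammer a m * (a + INR m))%C
  end.

Definition hyp2F1_term (a b c z : C) (n : nat) : C :=
  (pochhammer a n * pochhammer b n / (pochhammer c n * INR (fact n)) * z ^ n)%C.

(** Coquelicot's total operator [Series] is only available for real series, so
    the complex sum is taken componentwise.  It is meaningful for
    [Cmod z < 1] and [c] not a nonpositive integer. *)
Definition hyp2F1 (a b c z : C) : C :=
  (Series (fun n => Re (hyp2F1_term a b c z n)),
   Series (fun n => Im (hyp2F1_term a b c z n))).

(** [ex_derive] is complex differentiability here: the scalar field inferred
    from the type of [f] is [C_AbsRing]. *)
Definition analytic_on_disk (f : C -> C) : Prop :=
  forall z : C, Cmod z < 1 -> ex_derive f z.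

(** [z f'(z) / f(z)], extended by its limit value at the origin for
    [f] with [f 0 = 0] and [f' 0 = 1]. *)
Definition starlike_quotient (f : C -> C) (z : C) : C :=
  if Ceq_dec z 0 then RtoC 1 else (z * C_derive f z / f z)%C.

(** Division in [C] is total, so that the quotient is defined away from the
    origin has to be required separately. *)
Definition starlike_of_order (alpha : R) (f : C -> C) : Prop :=
  analytic_on_disk f /\
  f 0 = RtoC 0 /\
  C_derive f 0 = RtoC 1 /\
  (forall z : C, Cmod z < 1 -> z <> 0 -> f z <> 0) /\
  (forall z : C, Cmod z < 1 -> Re (starlike_quotient f z) > alpha).

(* Main.v *)
Require Import Defs.
From Stdlib Require Import Reals Lra Lia Classical ClassicalEpsilon.
From Coquelicot Require Import Coquelicot.
Open Scope R_scope.

(** Write [F] for the hypergeometric series, [theta = z d/dz],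
    [beta = 1 - alpha] and [q = theta F / F]. Since the starlike quotient of
    [z F] is [1 + q], the claim is that [F] has no zero and [Re q > - beta] on
    the disk. Both are contained in the positivity of the continuous function
    [Re (conj F * (theta F + beta F)) = |F|^2 (Re q + beta)], called
    [order_form]; it equals [beta] at the origin.

    Suppose that it is not positive everywhere, and let [z0] be a point of least
    modulus where it fails to be ([first_nonpositive_point]). Along the radius
    to [z0], the form being positive makes [|z F|] increase, so [F z0 <> 0] and
    [q z0 = - beta + i t]. Jack's lemma in the sharp form of Miller and Mocanu
    ([jack_at_first_violation]) then says that [kappa = theta q] is real at
    [z0] and that [kappa <= - (beta^2 + t^2) / (2 beta)]. To get it, note that
    [theta F / (2 beta F + theta F)], which is up to sign the Cayley transform
    of [1 + q / beta], vanishes at the origin and has modulus less than 1 for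
    [|z| < |z0|]. Schwarz's lemma bounds it by [|z| / |z0|] there, with equality
    of moduli at [z0]; differentiating this inequality at [z0], in the
    directions that point into the disk, gives the two properties of [kappa].

    The hypergeometric equation
    [theta (theta + c - 1) F = z (theta + a) (theta + b) F] ([hyp2F1_ode]) reads
    [kappa + A = z (kappa + B)] with [A = q (q + c - 1)] and
    [B = (q + a) (q + b)]. The reality of [p] and [Re (ab) > p beta] make
    [|kappa + A|^2 - |kappa + B|^2] decrease in [kappa]. At the largest
    admissible [kappa] it is the quadratic form [L t^2 - 2 M t beta + N beta^2]
    ([boundary_form_identity]), nonnegative by hypothesis. Hence
    [|kappa + A| >= |kappa + B|], and [|z0| < 1] forces both sides to vanish,
    so that [Re (B - A) = Re (ab) - p beta = 0], a contradiction
    ([no_boundary_point]).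

    The function theory used on the way is obtained directly for power series:
    termwise differentiation ([is_derive_PS]), and a maximum modulus principle
    ([maximum_modulus]) from the second derivative test applied to
    [|u|^2 + eps |z|^2]. *)

(** * Complex derivatives *)

(** Every estimate below is made in this form, which hides the two uniform
    structures that [C] carries. *)
Lemma C_is_derive_iff (u : C -> C) (z l : C) :
  is_derive u z l <->
  (forall eps, 0 < eps -> exists del, 0 < del /\ forall h : C, Cmod h < del ->
     Cmod (u (z + h) - u z - h * l)%C <= eps * Cmod h).
Proof.
split.
- intros [_ H] eps He.
  destruct (H z (fun P HP => HP) (mkposreal eps He)) as [d Hd].
  exists d; split; [apply cond_pos|].
  intros h Hh.
  assert (E : (z + h - z)%C = h) by ring.
  specialize (Hd (z + h)%C).
  assert (B : @ball (AbsRing_UniformSpace C_AbsRing) z d (z + h)%C).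
  { change (Cmod (z + h - z)%C < d). now rewrite E. }
  specialize (Hd B).
  change (Cmod (u (z + h) - u z - (z + h - z) * l)%C <= eps * Cmod (z + h - z)%C) in Hd.
  now rewrite E in Hd.
- intros H; split.
  + apply is_linear_scal_l.
  + intros x Hx.
    assert (E : z = x).
    { exact (@is_filter_lim_locally_unique C_AbsRing (AbsRing_NormedModule C_AbsRing) z x Hx). }
    subst x. intros eps.
    destruct (H eps (cond_pos eps)) as [d [Hd H1]].
    exists (mkposreal d Hd). intros y Hy. change C in y.
    change (Cmod (y - z)%C < d) in Hy.
    change (Cmod (u y - u z - (y - z) * l)%C <= eps * Cmod (y - z)%C).
    specialize (H1 _ Hy). replace (z + (y - z))%C with (y : C) in H1 by (simpl in *; ring). exact H1.
Qed.

Lemma C_is_derive_continuous (u : C -> C) (z l : C) :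
  is_derive u z l -> continuous u z.
Proof.
intros H P HP. apply locally_C.
apply (ex_derive_continuous (K := C_AbsRing) (V := C_NormedModule) u z).
- now exists l.
- exact HP.
Qed.

Lemma C_is_derive_const (k z : C) : is_derive (fun _ : C => k) z (RtoC 0).
Proof. exact (is_derive_const (K := C_AbsRing) (V := C_NormedModule) k z). Qed.

Lemma C_is_derive_id (z : C) : is_derive (fun y : C => y) z (RtoC 1).
Proof.
apply C_is_derive_iff. intros eps He. exists 1. split; [lra|]. intros h _.
replace (z + h - z - h * 1)%C with (RtoC 0) by ring.
rewrite Cmod_0. apply Rmult_le_pos; [lra|apply Cmod_ge_0].
Qed.

Lemma C_is_derive_minus (u v : C -> C) (z lu lv : C) :
  is_derive u z lu -> is_derive v z lv ->
  is_derive (fun y => u y - v y)%C z (lu - lv)%C.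
Proof. exact (is_derive_minus (K := C_AbsRing) (V := C_NormedModule) u v z lu lv). Qed.

Lemma C_is_derive_bound (u : C -> C) (z l : C) :
  is_derive u z l -> exists del, 0 < del /\ forall h : C, Cmod h < del ->
    Cmod (u (z + h) - u z)%C <= (Cmod l + 1) * Cmod h.
Proof.
intros H. destruct (proj1 (C_is_derive_iff u z l) H 1 Rlt_0_1) as [d [Hd H1]].
exists d. split; [exact Hd|]. intros h Hh. specialize (H1 h Hh).
replace (u (z + h) - u z)%C with ((u (z + h) - u z - h * l) + h * l)%C by ring.
eapply Rle_trans; [apply Cmod_triangle|]. rewrite (Cmod_mult h l). lra.
Qed.

Lemma C_is_derive_mult (u v : C -> C) (z lu lv : C) :
  is_derive u z lu -> is_derive v z lv ->
  is_derive (fun y => u y * v y)%C z (lu * v z + u z * lv)%C.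
Proof.
intros Hu Hv. apply C_is_derive_iff. intros eps He.
set (A := Cmod (v z) + Cmod (u z) + (Cmod lu + 1) * (Cmod lv + 1) + 1).
pose proof (Cmod_ge_0 lu). pose proof (Cmod_ge_0 lv).
pose proof (Cmod_ge_0 (u z)). pose proof (Cmod_ge_0 (v z)).
assert (HA : 1 <= A). { unfold A. assert (0 <= (Cmod lu + 1) * (Cmod lv + 1)) by nra. lra. }
assert (He' : 0 < eps / A). { apply Rdiv_lt_0_compat; lra. }
destruct (proj1 (C_is_derive_iff u z lu) Hu _ He') as [d1 [Hd1 B1]].
destruct (proj1 (C_is_derive_iff v z lv) Hv _ He') as [d2 [Hd2 B2]].
destruct (C_is_derive_bound u z lu Hu) as [d3 [Hd3 B3]].
destruct (C_is_derive_bound v z lv Hv) as [d4 [Hd4 B4]].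
exists (Rmin (Rmin d1 d2) (Rmin (Rmin d3 d4) (eps / A))). split.
- repeat apply Rmin_pos; assumption.
- intros h Hh.
  assert (Hh' : Cmod h < d1 /\ Cmod h < d2 /\ Cmod h < d3 /\ Cmod h < d4 /\ Cmod h < eps / A).
  { revert Hh. unfold Rmin. repeat destruct Rle_dec; intros; repeat split; lra. }
  destruct Hh' as (K1 & K2 & K3 & K4 & K5).
  specialize (B1 h K1). specialize (B2 h K2). specialize (B3 h K3). specialize (B4 h K4).
  pose proof (Cmod_ge_0 h).
  replace (u (z + h) * v (z + h) - u z * v z - h * (lu * v z + u z * lv))%C with
    ((u (z + h) - u z - h * lu) * v z + u z * (v (z + h) - v z - h * lv)
     + (u (z + h) - u z) * (v (z + h) - v z))%C by ring.
  eapply Rle_trans; [apply Cmod_triangle|].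
  eapply Rle_trans; [apply Rplus_le_compat_r; apply Cmod_triangle|].
  rewrite !Cmod_mult.
  replace (eps * Cmod h) with (eps / A * A * Cmod h) by (field; lra).
  set (e := eps / A) in *.
  assert (Cmod (u (z + h) - u z - h * lu)%C * Cmod (v z) <= e * Cmod h * Cmod (v z))
    by (apply Rmult_le_compat_r; assumption).
  assert (Cmod (u z) * Cmod (v (z + h) - v z - h * lv)%C <= Cmod (u z) * (e * Cmod h))
    by (apply Rmult_le_compat_l; assumption).
  assert (Cmod (u (z + h) - u z)%C * Cmod (v (z + h) - v z)%C <=
    ((Cmod lu + 1) * Cmod h) * ((Cmod lv + 1) * Cmod h))
    by (apply Rmult_le_compat; auto using Cmod_ge_0).
  assert (((Cmod lu + 1) * Cmod h) * ((Cmod lv + 1) * Cmod h) <=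
     (Cmod lu + 1) * (Cmod lv + 1) * Cmod h * e).
  { replace (((Cmod lu + 1) * Cmod h) * ((Cmod lv + 1) * Cmod h)) with
      ((Cmod lu + 1) * (Cmod lv + 1) * Cmod h * Cmod h) by ring.
    apply Rmult_le_compat_l; [|lra]. apply Rmult_le_pos; [nra|lra]. }
  unfold A. nra.
Qed.

Lemma C_is_derive_inv (u : C -> C) (z l : C) :
  is_derive u z l -> u z <> RtoC 0 ->
  is_derive (fun y => / u y)%C z (- l / (u z * u z))%C.
Proof.
intros Hu Hz. apply C_is_derive_iff. intros eps He.
pose proof (Cmod_gt_0 (u z)) as [Hm _]. specialize (Hm Hz).
set (m := Cmod (u z)) in *.
destruct (C_is_derive_bound u z l Hu) as [d1 [Hd1 H1]].
pose proof (Cmod_ge_0 l) as Hl. set (k := Cmod l + 1) in *.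
assert (Hk : 0 < k) by (unfold k; lra).
assert (He' : 0 < eps * (m * m) / 2 / 2).
{ assert (0 < eps * (m * m)) by (repeat apply Rmult_lt_0_compat; lra). lra. }
destruct (proj1 (C_is_derive_iff u z l) Hu _ He') as [d2 [Hd2 H2]].
set (d3 := m / (2 * k)).
assert (Hd3 : 0 < d3) by (apply Rdiv_lt_0_compat; lra).
set (d4 := eps * (m * m) * m / (4 * k * k)).
assert (Hd4 : 0 < d4).
{ apply Rdiv_lt_0_compat; repeat apply Rmult_lt_0_compat; lra. }
exists (Rmin (Rmin d1 d2) (Rmin d3 d4)). split.
- repeat apply Rmin_pos; assumption.
- intros h Hh.
  assert (Hh' : Cmod h < d1 /\ Cmod h < d2 /\ Cmod h < d3 /\ Cmod h < d4).
  { revert Hh. unfold Rmin. repeat destruct Rle_dec; intros; repeat split; lra. }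
  destruct Hh' as (K1 & K2 & K3 & K4).
  specialize (H1 h K1). specialize (H2 h K2).
  pose proof (Cmod_ge_0 h) as Hh0.
  set (D := (u (z + h) - u z)%C) in *.
  assert (KD : Cmod D <= m / 2).
  { eapply Rle_trans; [exact H1|]. replace (m / 2) with (k * d3) by (unfold d3; field; lra).
    apply Rmult_le_compat_l; lra. }
  assert (Hw : m / 2 <= Cmod (u (z + h)%C)).
  { assert (m <= Cmod (u (z + h)%C) + Cmod D).
    { unfold m. replace (u z) with (u (z + h) + - D)%C by (unfold D; ring).
      eapply Rle_trans; [apply Cmod_triangle|]. rewrite Cmod_opp. lra. }
    lra. }
  assert (Hwn : u (z + h)%C <> RtoC 0).
  { intros E. rewrite E, Cmod_0 in Hw. lra. }
  replace (/ u (z + h) - / u z - h * (- l / (u z * u z)))%C with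
    ((h * l * D - u z * (D - h * l)) / (u z * u z * u (z + h)))%C
    by (unfold D; field; split; assumption).
  unfold Cdiv. rewrite Cmod_mult, Cmod_inv by (repeat apply Cmult_neq_0; assumption).
  rewrite !Cmod_mult. fold m.
  assert (Hden : m * m * (m / 2) <= m * m * Cmod (u (z + h)%C)).
  { apply Rmult_le_compat_l; nra. }
  assert (Hden0 : 0 < m * m * (m / 2)) by (repeat apply Rmult_lt_0_compat; lra).
  apply Rmult_le_reg_r with (m * m * Cmod (u (z + h)%C)); [lra|].
  rewrite Rmult_assoc, Rinv_l by lra. rewrite Rmult_1_r.
  apply Rle_trans with (eps * Cmod h * (m * m * (m / 2))).
  2: { apply Rmult_le_compat_l; [nra|exact Hden]. }
  unfold Cminus at 1. eapply Rle_trans; [apply Cmod_triangle|].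
  rewrite Cmod_opp, !Cmod_mult. fold m.
  assert (X1 : Cmod h * Cmod l * Cmod D <= Cmod h * k * (k * d4)).
  { apply Rmult_le_compat.
    - apply Rmult_le_pos; lra.
    - apply Cmod_ge_0.
    - apply Rmult_le_compat_l; unfold k; lra.
    - eapply Rle_trans; [exact H1|]. apply Rmult_le_compat_l; lra. }
  assert (X2 : m * Cmod (D - h * l)%C <= m * (eps * (m * m) / 2 / 2 * Cmod h)).
  { apply Rmult_le_compat_l; [lra|exact H2]. }
  assert (X3 : Cmod h * k * (k * d4) = Cmod h * (eps * (m * m) * m) / 4).
  { unfold d4. field. lra. }
  rewrite X3 in X1. lra.
Qed.

Lemma C_is_derive_div (u v : C -> C) (z lu lv : C) :
  is_derive u z lu -> is_derive v z lv -> v z <> RtoC 0 ->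
  is_derive (fun y => u y / v y)%C z ((lu * v z - u z * lv) / (v z * v z))%C.
Proof.
intros Hu Hv Hz.
replace ((lu * v z - u z * lv) / (v z * v z))%C
  with (lu * / v z + u z * (- lv / (v z * v z)))%C by (field; exact Hz).
exact (C_is_derive_mult u (fun y => / v y)%C z lu _ Hu (C_is_derive_inv v z lv Hv Hz)).
Qed.

Lemma Cmod_Re_Im_le (w : C) (x : R) : Cmod w <= x -> Rabs (Re w) <= x /\ Rabs (Im w) <= x.
Proof.
intros H. pose proof (Rmax_Cmod w) as K. split.
- eapply Rle_trans; [|exact H]. eapply Rle_trans; [apply Rmax_l|exact K].
- eapply Rle_trans; [|exact H]. eapply Rle_trans; [apply Rmax_r|exact K].
Qed.

Lemma is_derive_of_remainder (f : R -> R) (x l : R) :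
  (forall eps, 0 < eps -> exists del, 0 < del /\ forall h : R, Rabs h < del ->
     Rabs (f (x + h) - f x - h * l) <= eps * Rabs h) -> is_derive f x l.
Proof.
intros H. apply is_derive_Reals. intros eps He.
destruct (H (eps / 2) ltac:(lra)) as [d [Hd K]].
exists (mkposreal d Hd). intros h Hh0 Hh. simpl in Hh. specialize (K h Hh).
replace ((f (x + h) - f x) / h - l) with ((f (x + h) - f x - h * l) / h) by (field; assumption).
unfold Rdiv. rewrite Rabs_mult, Rabs_inv.
assert (0 < Rabs h) by now apply Rabs_pos_lt.
apply Rmult_lt_reg_r with (Rabs h); [assumption|].
rewrite Rmult_assoc, Rinv_l by lra. nra.
Qed.

(** All real-variable arguments below run along straight lines, so that the
    chain rule is only needed for affine inner functions. *)
Lemma is_derive_along_line (u : C -> C) (z v l : C) (t : R) :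
  is_derive u (z + t * v)%C l ->
  is_derive (fun s : R => Re (u (z + s * v)%C)) t (Re (v * l)%C) /\
  is_derive (fun s : R => Im (u (z + s * v)%C)) t (Im (v * l)%C).
Proof.
intros H.
assert (K : forall eps, 0 < eps -> exists del, 0 < del /\ forall h : R, Rabs h < del ->
  Cmod (u (z + (t + h)%R * v) - u (z + t * v) - h * (v * l))%C <= eps * Rabs h).
{ intros eps He. pose proof (Cmod_ge_0 v).
  assert (He' : 0 < eps / (Cmod v + 1)) by (apply Rdiv_lt_0_compat; lra).
  destruct (proj1 (C_is_derive_iff _ _ _) H _ He') as [d [Hd K]].
  exists (d / (Cmod v + 1)). split; [apply Rdiv_lt_0_compat; lra|].
  intros h Hh. pose proof (Rabs_pos h).
  assert (Hh' : Rabs h * (Cmod v + 1) < d).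
  { apply Rmult_lt_reg_r with (/ (Cmod v + 1)); [apply Rinv_0_lt_compat; lra|].
    rewrite Rmult_assoc, Rinv_r by lra. unfold Rdiv in Hh. lra. }
  specialize (K (h * v)%C). rewrite Cmod_mult, Cmod_R in K.
  replace (z + (t + h)%R * v)%C with (z + t * v + h * v)%C by (rewrite RtoC_plus; ring).
  replace (h * (v * l))%C with (h * v * l)%C by ring.
  eapply Rle_trans; [apply K; nra|].
  replace (eps * Rabs h) with (eps / (Cmod v + 1) * (Rabs h * (Cmod v + 1))) by (field; lra).
  apply Rmult_le_compat_l; nra. }
split; apply is_derive_of_remainder; intros eps He;
  destruct (K eps He) as [d [Hd K']]; exists d; (split; [exact Hd|]); intros h Hh;
  specialize (K' h Hh); apply Cmod_Re_Im_le in K'; destruct K' as [K1 K2].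
- eapply Rle_trans; [|exact K1]. right. f_equal.
  generalize (u (z + (t + h)%R * v)%C) (u (z + t * v)%C). intros. unfold Re, Im. simpl. ring.
- eapply Rle_trans; [|exact K2]. right. f_equal.
  generalize (u (z + (t + h)%R * v)%C) (u (z + t * v)%C). intros. unfold Re, Im. simpl. ring.
Qed.

(** * Compactness and the maximum modulus principle *)

(** Each point gets a ball whose radius is at most the gap that [f] leaves below
    its supremum on that ball. A Lebesgue number of this cover is then a gap on
    all of [K], against the definition of the supremum. Passing to [atan o f]
    makes the supremum finite from the start. *)
Lemma compact_attains_max (K : C -> Prop) (f : C -> R) (B : R) :
  (exists z, K z) ->
  (forall z, K z -> Cmod z <= B) ->
  (forall z, ~ K z -> locally z (fun y => ~ K y)) ->
  (forall z, K z -> continuous f z) ->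
  exists z, K z /\ forall y, K y -> f y <= f z.
Proof.
intros [z0 Hz0] HB Hcl Hf.
apply NNPP. intros Hno.
set (g := fun z => atan (f z)).
destruct (completeness (fun x => exists z, K z /\ x = g z)) as [S [HS1 HS2]].
{ exists (PI / 2). intros x [z [_ ->]]. unfold g. pose proof (atan_bound (f z)). lra. }
{ now exists (g z0), z0. }
assert (HS : forall z, K z -> g z < S).
{ intros z Kz. destruct (Rle_lt_or_eq_dec (g z) S) as [H|H]; [apply HS1; now exists z|exact H|].
  exfalso. apply Hno. exists z. split; [exact Kz|]. intros y Ky.
  destruct (Rle_lt_dec (f y) (f z)) as [H'|H']; [exact H'|].
  apply atan_increasing in H'. assert (g y <= S) by (apply HS1; now exists y).
  unfold g in *. lra. }
assert (Hd : forall z : C, exists d : posreal, forall y : C,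
  Rabs (fst y - fst z) < d -> Rabs (snd y - snd z) < d -> K y -> g y <= S - d).
{ intros z. destruct (classic (K z)) as [Kz|Kz].
  - assert (He : 0 < (S - g z) / 2) by (specialize (HS z Kz); lra).
    assert (Hg : continuous g z).
    { apply (continuous_comp f atan); [now apply Hf|].
      apply continuity_pt_filterlim. apply derivable_continuous_pt, derivable_pt_atan. }
    destruct (proj1 (filterlim_locally _ _) Hg (mkposreal _ He)) as [d0 Hd0].
    exists (mkposreal _ (Rmin_pos _ _ (cond_pos d0) He)). simpl.
    intros y Hy1 Hy2 Ky.
    pose proof (Rmin_l d0 ((S - g z) / 2)). pose proof (Rmin_r d0 ((S - g z) / 2)).
    assert (Hb : ball z d0 y) by (split; [change (Rabs (fst y - fst z) < d0) | change (Rabs (snd y - snd z) < d0)]; lra).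
    specialize (Hd0 y Hb). change (Rabs (g y - g z) < (S - g z) / 2) in Hd0.
    apply Rabs_def2 in Hd0. lra.
  - destruct (Hcl z Kz) as [d0 Hd0]. exists d0. intros y Hy1 Hy2 Ky.
    exfalso. apply (Hd0 y); [|exact Ky]. split; assumption. }
set (delta := fun z => proj1_sig (constructive_indefinite_description _ (Hd z))).
assert (Hdelta := fun z => proj2_sig (constructive_indefinite_description _ (Hd z))).
change (forall z y : C, Rabs (fst y - fst z) < delta z -> Rabs (snd y - snd z) < delta z ->
  K y -> g y <= S - delta z) in Hdelta.
destruct (compactness_value_2d (-B) B (-B) B (fun x y => delta (x, y))) as [d Hcov].
assert (Hub : S <= S - d).
{ apply HS2. intros x [y [Ky ->]].
  apply NNPP. intros Hn.
  pose proof (HB y Ky) as HBy. destruct (Cmod_Re_Im_le y B HBy) as [B1 B2].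
  apply Rabs_le_between in B1. apply Rabs_le_between in B2.
  apply (Hcov (fst y) (snd y) B1 B2). intros (u & v & _ & _ & H1 & H2 & H3).
  apply Hn. apply Rle_trans with (S - delta (u, v)); [|lra].
  apply Hdelta; assumption. }
pose proof (cond_pos d). lra.
Qed.

Lemma locally_lt_of_continuous (f : C -> R) (z : C) (k : R) :
  continuous f z -> k < f z -> locally z (fun y => k < f y).
Proof. intros Hf Hk. apply (Hf (fun x => k < x)). now apply open_gt. Qed.

Lemma continuous_Cmod2 (u : C -> C) (z : C) :
  continuous u z -> continuous (fun y => Cmod (u y) ^ 2) z.
Proof.
intros Hu.
assert (H1 : continuous (fun y => fst (u y)) z).
{ apply (continuous_comp u fst); [exact Hu|]. destruct (u z). apply continuous_fst. }
assert (H2 : continuous (fun y => snd (u y)) z).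
{ apply (continuous_comp u snd); [exact Hu|]. destruct (u z). apply continuous_snd. }
apply (continuous_ext (fun y => plus (fst (u y) * fst (u y)) (snd (u y) * snd (u y)))).
{ intros y. rewrite Cmod2_alt. unfold Re, Im. unfold plus; simpl; ring. }
apply @continuous_plus; now apply @continuous_mult.
Qed.

Lemma open_Cmod_gt (z : C) (r : R) : r < Cmod z -> locally z (fun y => r < Cmod y).
Proof.
intros H. destruct (Rlt_le_dec r 0) as [Hr|Hr].
{ apply filter_forall. intros y. pose proof (Cmod_ge_0 y). lra. }
assert (K : locally z (fun y => r ^ 2 < Cmod y ^ 2)).
{ apply locally_lt_of_continuous; [|nra].
  apply (continuous_Cmod2 (fun y => y)), continuous_id. }
revert K. apply filter_imp. intros y Hy. pose proof (Cmod_ge_0 y).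
apply Rnot_le_lt. intros Hn. nra.
Qed.

Lemma no_max_if_second_derivative_pos (s s' : R -> R) (r l : R) :
  0 < r ->
  (forall t, Rabs t < r -> is_derive s t (s' t)) ->
  is_derive s' 0 l -> 0 < l ->
  ~ (forall t, Rabs t < r -> s t <= s 0).
Proof.
intros Hr Hs Hs' Hl Hmax.
assert (H0 : s' 0 = 0).
{ assert (D : derivable_pt_lim s 0 (s' 0)).
  { apply is_derive_Reals, Hs. rewrite Rabs_R0. lra. }
  assert (pr : derivable_pt s 0) by (exists (s' 0); exact D).
  rewrite <- (derive_pt_eq_0 s 0 (s' 0) pr D).
  apply (deriv_maximum s (-r) r 0 pr); try lra.
  intros x Hx1 Hx2. apply Hmax. apply Rabs_def1; lra. }
apply is_derive_Reals in Hs'. destruct (Hs' l Hl) as [d Hd].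
set (t := Rmin d r / 2).
assert (Ht : 0 < t /\ t < d /\ t < r).
{ pose proof (cond_pos d). pose proof (Rmin_pos d r). pose proof (Rmin_l d r). pose proof (Rmin_r d r).
  unfold t. lra. }
destruct Ht as (Ht0 & Ht1 & Ht2).
destruct (MVT_cor2 s s' 0 t Ht0) as [x [E Hx]].
{ intros x Hx. apply is_derive_Reals, Hs, Rabs_def1; lra. }
assert (Hst : s t <= s 0) by (apply Hmax, Rabs_def1; lra).
assert (Hx0 : s' x <= 0) by nra.
assert (Hq : s' x / x <= 0).
{ unfold Rdiv. assert (0 < / x) by (apply Rinv_0_lt_compat; lra). nra. }
specialize (Hd x ltac:(lra) ltac:(apply Rabs_def1; lra)).
rewrite Rplus_0_l, H0, Rminus_0_r in Hd. apply Rabs_def2 in Hd. lra.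
Qed.

Lemma is_derive_eq (f g : R -> R) (t l l' : R) :
  is_derive f t l -> (forall s, f s = g s) -> l = l' -> is_derive g t l'.
Proof. intros H Hfg <-. now apply (is_derive_ext f). Qed.

Lemma is_derive_dot (A B D E : R -> R) (t a b d e : R) :
  is_derive A t a -> is_derive B t b -> is_derive D t d -> is_derive E t e ->
  is_derive (fun s => A s * D s + B s * E s) t (a * D t + A t * d + (b * E t + B t * e)).
Proof.
intros HA HB HD HE.
apply is_derive_Reals in HA, HB, HD, HE. apply is_derive_Reals.
apply (derivable_pt_lim_plus (fun s => A s * D s) (fun s => B s * E s)).
- now apply (derivable_pt_lim_mult A D).
- now apply (derivable_pt_lim_mult B E).
Qed.

Lemma is_derive_Cmod2_line (u : C -> C) (z v l : C) (t : R) :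
  is_derive u (z + t * v)%C l ->
  is_derive (fun s : R => Cmod (u (z + s * v)%C) ^ 2) t
    (2 * Re (Cconj (u (z + t * v)) * (v * l))%C).
Proof.
intros H. destruct (is_derive_along_line u z v _ t H) as [H1 H2].
pose proof (is_derive_dot _ _ _ _ t _ _ _ _ H1 H2 H1 H2) as K.
apply (is_derive_eq _ _ _ _ _ K).
{ intros s. rewrite Cmod2_alt. ring. }
generalize (u (z + t * v)%C) (v * l)%C. intros x y. unfold Re, Im. simpl. ring.
Qed.

Lemma is_derive_Cmod2_line_second (u u' : C -> C) (z v l : C) (t : R) :
  is_derive u (z + t * v)%C (u' (z + t * v)%C) ->
  is_derive u' (z + t * v)%C l ->
  is_derive (fun s : R => 2 * Re (Cconj (u (z + s * v)) * (v * u' (z + s * v)))%C) t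
    (2 * Cmod (v * u' (z + t * v))%C ^ 2 + 2 * Re (Cconj (u (z + t * v)) * (v * v * l))%C).
Proof.
intros H H'. destruct (is_derive_along_line u z v _ t H) as [H1 H2].
assert (H'' : is_derive (fun y => v * u' y)%C (z + t * v)%C (v * l)%C).
{ replace (v * l)%C with (0 * u' (z + t * v) + v * l)%C by ring.
  apply (C_is_derive_mult (fun _ => v) u'); [apply C_is_derive_const|exact H']. }
destruct (is_derive_along_line _ z v _ t H'') as [H3 H4].
pose proof (is_derive_dot _ _ _ _ t _ _ _ _ H1 H2 H3 H4) as K.
apply (fun K => is_derive_scal _ t 2 _ K) in K.
apply (is_derive_eq _ _ _ _ _ K).
{ intros s. apply f_equal. generalize (u (z + s * v)%C) (v * u' (z + s * v))%C.
  intros x y. unfold Re, Im. simpl. ring. }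
rewrite Cmod2_alt.
replace (v * (v * l))%C with (v * v * l)%C by ring.
generalize (u (z + t * v)%C) (v * u' (z + t * v))%C (v * v * l)%C. intros x y w.
change @mult with Rmult. unfold Re, Im. simpl. ring.
Qed.

(** Adding [eps |z|^2] makes the subharmonic function [|u|^2] strictly
    subharmonic: the second derivatives in the directions [1] and [Ci] add up to
    [4 |u'|^2 + 4 eps > 0], which excludes an interior maximum without any local
    expansion of [u]. *)
Lemma maximum_modulus (u u' : C -> C) (r rho m : R) :
  0 < rho < r ->
  (forall z, Cmod z < r -> is_derive u z (u' z)) ->
  (forall z, Cmod z < r -> ex_derive u' z) ->
  (forall z, Cmod z = rho -> Cmod (u z) <= m) ->
  forall z, Cmod z <= rho -> Cmod (u z) <= m.
Proof.
intros Hr Hu Hu' Hm.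
assert (Hm0 : 0 <= m).
{ apply Rle_trans with (Cmod (u (RtoC rho))); [apply Cmod_ge_0|]. apply Hm.
  rewrite Cmod_R. apply Rabs_pos_eq. lra. }
assert (Heps : forall eps, 0 < eps -> forall z, Cmod z <= rho ->
  Cmod (u z) ^ 2 + eps * Cmod z ^ 2 <= m ^ 2 + eps * rho ^ 2).
{ intros eps He.
  destruct (compact_attains_max (fun z => Cmod z <= rho)
    (fun z => Cmod (u z) ^ 2 + eps * Cmod z ^ 2) rho) as [z0 [Hz0 Hmax]].
  - exists (RtoC 0). rewrite Cmod_0. lra.
  - auto.
  - intros z Hz. apply Rnot_le_lt, open_Cmod_gt in Hz. revert Hz. apply filter_imp. intros y Hy. lra.
  - intros z Hz. apply @continuous_plus.
    + apply continuous_Cmod2, (C_is_derive_continuous u z (u' z)), Hu. lra.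
    + apply @continuous_scal_r. apply (continuous_Cmod2 (fun y => y)), continuous_id.
  - intros z Hz. eapply Rle_trans; [exact (Hmax z Hz)|].
    destruct (Rle_lt_or_eq_dec _ _ Hz0) as [Hlt|Heq].
    2: { rewrite Heq. specialize (Hm z0 Heq). pose proof (Cmod_ge_0 (u z0)). nra. }
    exfalso. destruct (Hu' z0 ltac:(lra)) as [l Hl]. change C in l.
    assert (Hdir : forall v : C, Cmod v = 1 ->
      2 * Cmod (v * u' z0)%C ^ 2 + 2 * Re (Cconj (u z0) * (v * v * l))%C + 2 * eps <= 0).
    { intros v Hv. apply Rnot_lt_le. intros Hpos.
      assert (Hin : forall t : R, Rabs t < rho - Cmod z0 -> Cmod (z0 + t * v)%C < rho).
      { intros t Ht. eapply Rle_lt_trans; [apply Cmod_triangle|].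
        rewrite Cmod_mult, Cmod_R, Hv. lra. }
      apply (no_max_if_second_derivative_pos
        (fun t => Cmod (u (z0 + t * v)%C) ^ 2 + eps * Cmod (z0 + t * v)%C ^ 2)
        (fun t => 2 * Re (Cconj (u (z0 + t * v)) * (v * u' (z0 + t * v)))%C
          + eps * (2 * Re (Cconj (z0 + t * v) * (v * 1))%C))
        (rho - Cmod z0) (2 * Cmod (v * u' z0)%C ^ 2 + 2 * Re (Cconj (u z0) * (v * v * l))%C
          + eps * (2 * Cmod (v * 1)%C ^ 2 + 2 * Re (Cconj z0 * (v * v * 0))%C))).
      - lra.
      - intros t Ht. specialize (Hin t Ht).
        apply @is_derive_plus.
        + apply is_derive_Cmod2_line, Hu. lra.
        + apply is_derive_scal. apply (is_derive_Cmod2_line (fun y => y)), C_is_derive_id.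
      - assert (E0 : (z0 + 0%R * v)%C = z0) by ring.
        eapply is_derive_eq; [apply @is_derive_plus|intros s; reflexivity|].
        + apply (is_derive_Cmod2_line_second u u'); [apply Hu; rewrite E0; lra|rewrite E0; exact Hl].
        + apply is_derive_scal.
          apply (is_derive_Cmod2_line_second (fun y => y) (fun _ => RtoC 1)).
          apply C_is_derive_id. apply C_is_derive_const.
        + rewrite !E0. reflexivity.
      - replace (v * v * 0)%C with (RtoC 0) by ring. rewrite !Cmult_0_r, Cmult_1_r, Hv.
        change (Re 0) with 0. lra.
      - intros t Ht. replace (z0 + 0%R * v)%C with z0 by ring. apply Hmax.
        specialize (Hin t Ht). lra. }
    (* The terms with l, the second derivative of u, cancel between the two directions,
       as 1^2 + i^2 = 0. *)
    pose proof (Hdir (RtoC 1) Cmod_1) as H1. pose proof (Hdir Ci Cmod_Ci) as H2.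
    replace (Ci * Ci * l)%C with (- (1 * 1 * l))%C in H2
      by (replace (Ci * Ci)%C with (RtoC (-1)) by (unfold Ci, Cmult, RtoC; simpl; f_equal; ring); ring).
    replace (Re (Cconj (u z0) * - (1 * 1 * l))%C) with
      (- Re (Cconj (u z0) * (1 * 1 * l))%C) in H2
      by (generalize (Cconj (u z0)) (1 * 1 * l)%C; intros; unfold Re, Im; simpl; ring).
    pose proof (pow2_ge_0 (Cmod (1 * u' z0)%C)). pose proof (pow2_ge_0 (Cmod (Ci * u' z0)%C)).
    lra. }
intros z Hz. apply Rnot_lt_le. intros Hlt.
set (d := Cmod (u z) ^ 2 - m ^ 2).
assert (Hd : 0 < d) by (unfold d; nra).
assert (He : 0 < d / (2 * rho ^ 2)) by (apply Rdiv_lt_0_compat; nra).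
specialize (Heps _ He z Hz).
assert (d / (2 * rho ^ 2) * rho ^ 2 = d / 2) by (field; lra).
assert (0 <= d / (2 * rho ^ 2) * Cmod z ^ 2) by (apply Rmult_le_pos; [lra|apply pow2_ge_0]).
unfold d in *. lra.
Qed.

(** * Complex power series *)

Definition C_series (w : nat -> C) : C :=
  (Series (fun n => Re (w n)), Series (fun n => Im (w n))).

Definition C_summable (w : nat -> C) : Prop := ex_series (fun n => Cmod (w n)).

Lemma C_summable_le (w : nat -> C) (x : nat -> R) :
  (forall n, Cmod (w n) <= x n) -> ex_series x -> C_summable w.
Proof.
intros H Hx. apply (ex_series_le (K := R_AbsRing) (V := R_CompleteNormedModule) _ x); [|exact Hx].
intros n. change (Rabs (Cmod (w n)) <= x n). rewrite Rabs_pos_eq by apply Cmod_ge_0. apply H.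
Qed.

Lemma C_summable_Re_Im (w : nat -> C) : C_summable w ->
  ex_series (fun n => Rabs (Re (w n))) /\ ex_series (fun n => Rabs (Im (w n))).
Proof.
intros H. split;
  apply (ex_series_le (K := R_AbsRing) (V := R_CompleteNormedModule) _ (fun n => Cmod (w n))); try exact H;
  intros n; destruct (Cmod_Re_Im_le (w n) _ (Rle_refl _)) as [H1 H2];
  change (Rabs (Rabs (Re (w n))) <= Cmod (w n)) || change (Rabs (Rabs (Im (w n))) <= Cmod (w n));
  rewrite Rabs_Rabsolu; assumption.
Qed.

Lemma C_series_ext (v w : nat -> C) : (forall n, v n = w n) -> C_series v = C_series w.
Proof. intros H. unfold C_series. f_equal; apply Series_ext; intros n; now rewrite H. Qed.

Lemma C_summable_plus (v w : nat -> C) :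
  C_summable v -> C_summable w -> C_summable (fun n => v n + w n)%C.
Proof.
intros Hv Hw. apply C_summable_le with (fun n => Cmod (v n) + Cmod (w n)).
- intros n. apply Cmod_triangle.
- apply (ex_series_plus (K := R_AbsRing) (V := R_NormedModule)); assumption.
Qed.

Lemma C_summable_scal (k : C) (w : nat -> C) :
  C_summable w -> C_summable (fun n => k * w n)%C.
Proof.
intros Hw. apply C_summable_le with (fun n => Cmod k * Cmod (w n)).
- intros n. rewrite Cmod_mult. lra.
- apply (ex_series_scal (K := R_AbsRing) (V := R_NormedModule)). exact Hw.
Qed.

Lemma C_series_plus (v w : nat -> C) : C_summable v -> C_summable w ->
  C_series (fun n => v n + w n)%C = (C_series v + C_series w)%C.
Proof.
intros Hv Hw. apply C_summable_Re_Im in Hv, Hw. destruct Hv, Hw.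
unfold C_series, Cplus. simpl. f_equal.
- apply Series_plus; now apply ex_series_Rabs.
- apply Series_plus; now apply ex_series_Rabs.
Qed.

Lemma C_series_scal (k : C) (w : nat -> C) : C_summable w ->
  C_series (fun n => k * w n)%C = (k * C_series w)%C.
Proof.
intros Hw. apply C_summable_Re_Im in Hw. destruct Hw as [H1 H2].
apply ex_series_Rabs in H1, H2.
assert (S1 : forall x, ex_series (fun n => x * Re (w n))).
{ intros x. apply (ex_series_scal (K := R_AbsRing) (V := R_NormedModule)), H1. }
assert (S2 : forall x, ex_series (fun n => x * Im (w n))).
{ intros x. apply (ex_series_scal (K := R_AbsRing) (V := R_NormedModule)), H2. }
unfold C_series, Cmult. simpl. rewrite <- !Series_scal_l. f_equal.
- apply Series_minus; [apply S1|apply S2].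
- apply Series_plus; [apply S2|apply S1].
Qed.

Lemma C_series_taylor_remainder (h : C) (u v w : nat -> C) :
  C_summable u -> C_summable v -> C_summable w ->
  C_series (fun n => u n - v n - h * w n)%C = (C_series u - C_series v - h * C_series w)%C.
Proof.
intros Hu Hv Hw.
assert (Hv' := C_summable_scal (-1) v Hv).
assert (Hw' := C_summable_scal (- h) w Hw).
rewrite (C_series_ext _ (fun n => (u n + (-1) * v n) + (- h) * w n)%C) by (intros n; ring).
rewrite C_series_plus, C_series_plus, !C_series_scal; try assumption; [ring|].
now apply C_summable_plus.
Qed.

Lemma C_series_incr_1 (w : nat -> C) : C_summable w ->
  C_series w = (w 0%nat + C_series (fun n => w (S n)))%C.
Proof.
intros Hw. apply C_summable_Re_Im in Hw. destruct Hw as [H1 H2].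
unfold C_series, Cplus. simpl.
f_equal; apply Series_incr_1; now apply ex_series_Rabs.
Qed.

(** The factor 2 is the price of working with real and imaginary parts; only
    some bound in terms of the moduli is needed. *)
Lemma Cmod_C_series_le (w : nat -> C) (x : nat -> R) :
  (forall n, Cmod (w n) <= x n) -> ex_series x ->
  Cmod (C_series w) <= 2 * Series x.
Proof.
intros H Hx. pose proof (C_summable_le w x H Hx) as Hw.
destruct (C_summable_Re_Im w Hw) as [H1 H2].
assert (Hpos : forall n, 0 <= x n).
{ intros n. eapply Rle_trans; [apply Cmod_ge_0|apply H]. }
assert (B : forall y : nat -> R, (forall n, Rabs (y n) <= x n) -> ex_series (fun n => Rabs (y n)) ->
  Rabs (Series y) <= Series x).
{ intros y Hy Ey. eapply Rle_trans; [apply Series_Rabs; exact Ey|].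
  apply Series_le; [|exact Hx]. intros n. split; [apply Rabs_pos|apply Hy]. }
assert (B1 : Rabs (Series (fun n => Re (w n))) <= Series x).
{ apply B; [|exact H1]. intros n. exact (proj1 (Cmod_Re_Im_le _ _ (H n))). }
assert (B2 : Rabs (Series (fun n => Im (w n))) <= Series x).
{ apply B; [|exact H2]. intros n. exact (proj2 (Cmod_Re_Im_le _ _ (H n))). }
eapply Rle_trans; [apply Cmod_2Rmax|].
unfold C_series. simpl.
assert (Rmax (Rabs (Series (fun n => Re (w n)))) (Rabs (Series (fun n => Im (w n)))) <= Series x)
  by (apply Rmax_lub; assumption).
assert (sqrt 2 <= 2).
{ rewrite <- (sqrt_square 2) at 2 by lra. apply sqrt_le_1; lra. }
pose proof (sqrt_pos 2).
assert (0 <= Series x) by (pose proof (Rabs_pos (Series (fun n => Re (w n)))); lra).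
apply Rle_trans with (sqrt 2 * Series x); [apply Rmult_le_compat_l; assumption|].
apply Rmult_le_compat_r; assumption.
Qed.

Definition PS (k : nat -> C) (z : C) : C := C_series (fun n => k n * z ^ n)%C.

(** By Abel's lemma this says that the radius of convergence is at least 1;
    boundedness is easier to transport through the operations than
    summability. *)
Definition radius_ge_1 (k : nat -> C) : Prop :=
  forall rho, 0 <= rho < 1 -> exists M, forall n, Cmod (k n) * rho ^ n <= M.

Lemma radius_ge_1_summable (k : nat -> C) (rho : R) :
  radius_ge_1 k -> 0 <= rho < 1 -> ex_series (fun n => Cmod (k n) * rho ^ n).
Proof.
intros Hk Hrho. set (s := (rho + 1) / 2).
assert (Hs : rho < s < 1) by (unfold s; lra).
destruct (Hk s ltac:(lra)) as [M HM].
apply (ex_series_le (K := R_AbsRing) (V := R_CompleteNormedModule) _ (fun n => M * (rho / s) ^ n)).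
- intros n. change (Rabs (Cmod (k n) * rho ^ n) <= M * (rho / s) ^ n).
  rewrite Rabs_pos_eq by (apply Rmult_le_pos; [apply Cmod_ge_0|apply pow_le; lra]).
  replace (Cmod (k n) * rho ^ n) with (Cmod (k n) * s ^ n * (rho / s) ^ n).
  + apply Rmult_le_compat_r; [|apply HM]. apply pow_le, Rdiv_le_0_compat; lra.
  + rewrite Rmult_assoc, <- Rpow_mult_distr. do 2 f_equal. field. lra.
- apply (ex_series_scal (K := R_AbsRing) (V := R_NormedModule)). apply ex_series_geom.
  rewrite Rabs_pos_eq by (apply Rdiv_le_0_compat; lra).
  apply Rmult_lt_reg_r with s; [lra|]. unfold Rdiv. rewrite Rmult_assoc, Rinv_l; lra.
Qed.

Lemma PS_summable (k : nat -> C) (z : C) :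
  radius_ge_1 k -> Cmod z < 1 -> C_summable (fun n => k n * z ^ n)%C.
Proof.
intros Hk Hz. apply C_summable_le with (fun n => Cmod (k n) * Cmod z ^ n).
- intros n. rewrite Cmod_mult, Cmod_pow. lra.
- apply radius_ge_1_summable; [exact Hk|]. pose proof (Cmod_ge_0 z). lra.
Qed.

Lemma INR_mult_pow_bounded (x : R) : 0 <= x < 1 -> exists K, 0 <= K /\ forall n, INR n * x ^ n <= K.
Proof.
intros [[Hx| <-] Hx1].
- assert (Hy : 0 < / x - 1).
  { apply Rlt_0_minus. rewrite <- Rinv_1. apply Rinv_lt_contravar; lra. }
  exists (/ (/ x - 1)). split; [now apply Rlt_le, Rinv_0_lt_compat|]. intros n.
  pose proof (poly n (/ x - 1) Hy) as Hp.
  replace (1 + (/ x - 1)) with (/ x) in Hp by ring.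
  rewrite pow_inv in Hp.
  assert (Hxn : 0 < x ^ n) by now apply pow_lt.
  apply Rmult_le_reg_r with (/ x - 1); [exact Hy|].
  rewrite Rinv_l by lra.
  apply Rle_trans with (x ^ n * / x ^ n); [|right; apply Rinv_r; lra].
  replace (INR n * x ^ n * (/ x - 1)) with (x ^ n * (INR n * (/ x - 1))) by ring.
  apply Rmult_le_compat_l; lra.
- exists 0. split; [lra|]. intros [|n]; simpl; lra.
Qed.

(** The coefficients of [z d/dz] applied to the series. *)
Definition theta (k : nat -> C) (n : nat) : C := (INR n * k n)%C.

Lemma radius_ge_1_theta (k : nat -> C) : radius_ge_1 k -> radius_ge_1 (theta k).
Proof.
intros Hk rho Hrho. set (s := (rho + 1) / 2).
assert (Hs : rho < s < 1) by (unfold s; lra).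
destruct (Hk s ltac:(lra)) as [M HM].
destruct (INR_mult_pow_bounded (rho / s)) as [K [HK0 HK]].
{ split; [apply Rdiv_le_0_compat; lra|].
  apply Rmult_lt_reg_r with s; [lra|]. unfold Rdiv. rewrite Rmult_assoc, Rinv_l; lra. }
exists (M * K). intros n. unfold theta.
rewrite Cmod_mult, Cmod_R, (Rabs_pos_eq (INR n)) by apply pos_INR.
replace (INR n * Cmod (k n) * rho ^ n) with (Cmod (k n) * s ^ n * (INR n * (rho / s) ^ n)).
- apply Rmult_le_compat; [| |apply HM|apply HK].
  + apply Rmult_le_pos; [apply Cmod_ge_0|apply pow_le; lra].
  + apply Rmult_le_pos; [apply pos_INR|apply pow_le, Rdiv_le_0_compat; lra].
- replace (rho ^ n) with (s ^ n * (rho / s) ^ n); [ring|].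
  rewrite <- Rpow_mult_distr. f_equal. field. lra.
Qed.

Lemma radius_ge_1_shift (k : nat -> C) :
  radius_ge_1 k -> radius_ge_1 (fun n => k (S n)).
Proof.
intros Hk rho Hrho. set (s := (rho + 1) / 2).
assert (Hs : rho < s < 1) by (unfold s; lra).
assert (Hs0 : 0 < s) by (unfold s; lra).
destruct (Hk s ltac:(lra)) as [M HM].
exists (M / s). intros n. specialize (HM (S n)). simpl in HM.
apply Rmult_le_reg_r with s; [exact Hs0|].
replace (M / s * s) with M by (field; lra).
eapply Rle_trans; [|exact HM].
replace (Cmod (k (S n)) * (s * s ^ n)) with (Cmod (k (S n)) * s ^ n * s) by ring.
apply Rmult_le_compat_r; [lra|]. apply Rmult_le_compat_l; [apply Cmod_ge_0|].
apply pow_incr. lra.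
Qed.

Lemma radius_ge_1_scal (l : C) (k : nat -> C) :
  radius_ge_1 k -> radius_ge_1 (fun n => l * k n)%C.
Proof.
intros Hk rho Hrho. destruct (Hk rho Hrho) as [M HM]. exists (Cmod l * M). intros n.
rewrite Cmod_mult, Rmult_assoc. apply Rmult_le_compat_l; [apply Cmod_ge_0|apply HM].
Qed.

Lemma radius_ge_1_plus (k l : nat -> C) :
  radius_ge_1 k -> radius_ge_1 l -> radius_ge_1 (fun n => k n + l n)%C.
Proof.
intros Hk Hl rho Hrho. destruct (Hk rho Hrho) as [M HM]. destruct (Hl rho Hrho) as [N HN].
exists (M + N). intros n.
apply Rle_trans with ((Cmod (k n) + Cmod (l n)) * rho ^ n).
- apply Rmult_le_compat_r; [apply pow_le; lra|apply Cmod_triangle].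
- specialize (HM n). specialize (HN n). lra.
Qed.

Lemma PS_plus (k l : nat -> C) (z : C) : radius_ge_1 k -> radius_ge_1 l -> Cmod z < 1 ->
  PS (fun n => k n + l n)%C z = (PS k z + PS l z)%C.
Proof.
intros Hk Hl Hz. unfold PS. rewrite <- C_series_plus by now apply PS_summable.
apply C_series_ext. intros n. ring.
Qed.

Lemma PS_scal (l : C) (k : nat -> C) (z : C) : radius_ge_1 k -> Cmod z < 1 ->
  PS (fun n => l * k n)%C z = (l * PS k z)%C.
Proof.
intros Hk Hz. unfold PS. rewrite <- C_series_scal by now apply PS_summable.
apply C_series_ext. intros n. ring.
Qed.

Lemma PS_incr_1 (k : nat -> C) (z : C) : radius_ge_1 k -> Cmod z < 1 ->
  PS k z = (k 0%nat + z * PS (fun n => k (S n)) z)%C.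
Proof.
intros Hk Hz. unfold PS at 1. rewrite C_series_incr_1 by now apply PS_summable.
unfold PS. rewrite <- C_series_scal by (apply PS_summable; [now apply radius_ge_1_shift|exact Hz]).
f_equal; [simpl; ring|]. apply C_series_ext. intros n. simpl. ring.
Qed.

Definition PS_deriv (k : nat -> C) (n : nat) : C := (INR (S n) * k (S n))%C.

Lemma radius_ge_1_deriv (k : nat -> C) : radius_ge_1 k -> radius_ge_1 (PS_deriv k).
Proof.
intros Hk. exact (radius_ge_1_shift (theta k) (radius_ge_1_theta k Hk)).
Qed.

(** The bound [n^2 rho^(n-2) |h|^2] on the remainder, multiplied by [rho^2] so as
    not to subtract from the exponent. *)
Lemma pow_second_order_remainder (z h : C) (rho : R) (n : nat) :
  0 < rho -> Cmod z <= rho -> Cmod (z + h)%C <= rho ->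
  Cmod ((z + h) ^ n - z ^ n - h * (INR n * z ^ pred n))%C * rho ^ 2
  <= INR n ^ 2 * rho ^ n * Cmod h ^ 2.
Proof.
intros Hrho Hz Hzh. induction n as [|n IH].
- simpl. replace (1 - 1 - h * (0 * 1))%C with (RtoC 0) by ring. rewrite Cmod_0. lra.
- set (R0 := ((z + h) ^ n - z ^ n - h * (INR n * z ^ pred n))%C) in *.
  replace ((z + h) ^ S n - z ^ S n - h * (INR (S n) * z ^ pred (S n)))%C
    with (INR n * z ^ pred n * (h * h) + (z + h) * R0)%C.
  2: { unfold R0. rewrite S_INR, RtoC_plus. destruct n; simpl; ring. }
  apply Rle_trans with ((INR n * Cmod z ^ pred n * Cmod h ^ 2 + rho * Cmod R0) * rho ^ 2).
  { apply Rmult_le_compat_r; [apply pow2_ge_0|].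
    eapply Rle_trans; [apply Cmod_triangle|].
    rewrite !Cmod_mult, Cmod_pow, Cmod_R, (Rabs_pos_eq (INR n)) by apply pos_INR.
    apply Rplus_le_compat; [right; ring|].
    apply Rmult_le_compat_r; [apply Cmod_ge_0|exact Hzh]. }
  assert (G1 : INR n * Cmod z ^ pred n * rho <= INR n * rho ^ n).
  { destruct n as [|n]; [simpl; lra|]. simpl pred.
    rewrite Rmult_assoc. apply Rmult_le_compat_l; [apply pos_INR|].
    replace (rho ^ S n) with (rho ^ n * rho) by (simpl; ring).
    apply Rmult_le_compat_r; [lra|]. apply pow_incr. split; [apply Cmod_ge_0|exact Hz]. }
  rewrite S_INR. pose proof (pos_INR n). pose proof (pow2_ge_0 (Cmod h)).
  assert (0 < rho ^ n) by now apply pow_lt.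
  assert (G2 : rho * (Cmod R0 * rho ^ 2) <= rho * (INR n ^ 2 * rho ^ n * Cmod h ^ 2))
    by (apply Rmult_le_compat_l; lra).
  assert (G3 : INR n * Cmod z ^ pred n * rho * (Cmod h ^ 2 * rho) <= INR n * rho ^ n * (Cmod h ^ 2 * rho))
    by (apply Rmult_le_compat_r; [apply Rmult_le_pos; lra|exact G1]).
  assert (G4 : 0 <= (INR n + 1) * (rho ^ n * Cmod h ^ 2 * rho)).
  { pose proof (Cmod_ge_0 h). repeat apply Rmult_le_pos; lra. }
  change (rho ^ S n) with (rho * rho ^ n).
  replace ((INR n + 1) ^ 2 * (rho * rho ^ n) * Cmod h ^ 2) with
    (rho * (INR n ^ 2 * rho ^ n * Cmod h ^ 2) + INR n * rho ^ n * (Cmod h ^ 2 * rho)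
     + (INR n + 1) * (rho ^ n * Cmod h ^ 2 * rho)) by ring.
  replace ((INR n * Cmod z ^ pred n * Cmod h ^ 2 + rho * Cmod R0) * rho ^ 2) with
    (INR n * Cmod z ^ pred n * rho * (Cmod h ^ 2 * rho) + rho * (Cmod R0 * rho ^ 2)) by ring.
  lra.
Qed.

(** The Taylor remainders of the monomials, weighted by the coefficients, sum to
    a multiple of [|h|^2], because [theta (theta k)] still has radius of
    convergence at least 1. *)
Lemma is_derive_PS (k : nat -> C) (z : C) :
  radius_ge_1 k -> Cmod z < 1 -> is_derive (PS k) z (PS (PS_deriv k) z).
Proof.
intros Hk Hz. pose proof (Cmod_ge_0 z) as Hz0.
set (rho := (Cmod z + 1) / 2).
assert (Hrho : Cmod z < rho < 1) by (unfold rho; lra).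
assert (Hk2 : radius_ge_1 (theta (theta k))) by now apply radius_ge_1_theta, radius_ge_1_theta.
pose proof (radius_ge_1_summable _ rho Hk2 ltac:(lra)) as Hsum.
set (T := Series (fun n => Cmod (theta (theta k) n) * rho ^ n)) in *.
assert (HT : 0 <= T).
{ unfold T. apply Rle_trans with (Series (fun _ : nat => 0 * 0)).
  - rewrite Series_scal_l. lra.
  - apply Series_le; [|exact Hsum]. intros n. split; [lra|].
    rewrite Rmult_0_l. apply Rmult_le_pos; [apply Cmod_ge_0|apply pow_le; lra]. }
set (B := 2 * T / rho ^ 2).
assert (HB : 0 <= B) by (unfold B; apply Rdiv_le_0_compat; [lra|apply pow_lt; lra]).
apply C_is_derive_iff. intros eps He.
exists (Rmin (rho - Cmod z) (eps / (B + 1))). split.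
{ apply Rmin_pos; [lra|apply Rdiv_lt_0_compat; lra]. }
intros h Hh.
assert (Hh1 : Cmod h < rho - Cmod z) by (eapply Rlt_le_trans; [exact Hh|apply Rmin_l]).
assert (Hh2 : Cmod h < eps / (B + 1)) by (eapply Rlt_le_trans; [exact Hh|apply Rmin_r]).
assert (Hzh : Cmod (z + h)%C < rho) by (eapply Rle_lt_trans; [apply Cmod_triangle|lra]).
assert (Hd : C_summable (fun n => k n * (INR n * z ^ pred n))%C).
{ apply (ex_series_incr_1 (K := R_AbsRing) (V := R_NormedModule)).
  apply (C_summable_le _ (fun n => Cmod (PS_deriv k n * z ^ n)%C)).
  - intros n. right. f_equal. unfold PS_deriv. simpl pred. ring.
  - apply PS_summable; [now apply radius_ge_1_deriv|exact Hz]. }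
assert (Hdz : PS (PS_deriv k) z = C_series (fun n => k n * (INR n * z ^ pred n))%C).
{ rewrite C_series_incr_1 by exact Hd.
  simpl (INR 0). replace (k 0%nat * (0%R * z ^ pred 0))%C with (RtoC 0) by ring.
  rewrite Cplus_0_l. apply C_series_ext. intros n. unfold PS_deriv. simpl pred. ring. }
assert (E : (PS k (z + h) - PS k z - h * PS (PS_deriv k) z)%C =
  C_series (fun n => k n * ((z + h) ^ n - z ^ n - h * (INR n * z ^ pred n)))%C).
{ rewrite Hdz. unfold PS.
  rewrite <- C_series_taylor_remainder.
  - apply C_series_ext. intros n. ring.
  - apply PS_summable; [exact Hk|lra].
  - now apply PS_summable.
  - exact Hd. }
rewrite E.
apply Rle_trans with (2 * Series (fun n => Cmod h ^ 2 / rho ^ 2 * (Cmod (theta (theta k) n) * rho ^ n))).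
- apply Cmod_C_series_le.
  + intros n.
    pose proof (pow_second_order_remainder z h rho n ltac:(lra) ltac:(lra) ltac:(lra)) as Hp.
    assert (Hr2 : 0 < rho ^ 2) by (apply pow_lt; lra).
    apply Rmult_le_reg_r with (rho ^ 2); [exact Hr2|].
    unfold theta. rewrite !Cmod_mult, Cmod_R, (Rabs_pos_eq (INR n)) by apply pos_INR.
    replace (Cmod h ^ 2 / rho ^ 2 * (INR n * (INR n * Cmod (k n)) * rho ^ n) * rho ^ 2)
      with (Cmod (k n) * (INR n ^ 2 * rho ^ n * Cmod h ^ 2)) by (field; lra).
    rewrite Rmult_assoc. apply Rmult_le_compat_l; [apply Cmod_ge_0|exact Hp].
  + apply (ex_series_scal (K := R_AbsRing) (V := R_NormedModule)). exact Hsum.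
- rewrite Series_scal_l. fold T.
  replace (2 * (Cmod h ^ 2 / rho ^ 2 * T)) with (B * Cmod h * Cmod h) by (unfold B; field; lra).
  apply Rmult_le_compat_r; [apply Cmod_ge_0|].
  apply Rle_trans with (B * (eps / (B + 1))); [apply Rmult_le_compat_l; lra|].
  apply Rmult_le_reg_r with (B + 1); [lra|].
  replace (B * (eps / (B + 1)) * (B + 1)) with (B * eps) by (field; lra). nra.
Qed.

(** * The hypergeometric series *)

Definition hyp2F1_coef (a b c : C) (n : nat) : C :=
  (pochhammer a n * pochhammer b n / (pochhammer c n * INR (fact n)))%C.

Lemma hyp2F1_PS (a b c z : C) : hyp2F1 a b c z = PS (hyp2F1_coef a b c) z.
Proof. reflexivity. Qed.

Lemma RtoC_neq_0 (x : R) : x <> 0 -> RtoC x <> RtoC 0.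
Proof. intros H E. apply H. exact (RtoC_inj _ _ E). Qed.

Lemma Cplus_INR_neq_0 (c : C) (n : nat) : (forall m : nat, c <> RtoC (- INR m)) -> (c + INR n)%C <> RtoC 0.
Proof.
intros Hc E. apply (Hc n). rewrite RtoC_opp. replace c with ((c + INR n) + - INR n)%C by ring.
rewrite E. ring.
Qed.

Lemma pochhammer_neq_0 (c : C) (n : nat) :
  (forall m : nat, c <> RtoC (- INR m)) -> pochhammer c n <> RtoC 0.
Proof.
intros Hc. induction n as [|n IH]; simpl.
- apply RtoC_neq_0. lra.
- apply Cmult_neq_0; [exact IH|now apply Cplus_INR_neq_0].
Qed.

Lemma hyp2F1_coef_S (a b c : C) (n : nat) : (forall m : nat, c <> RtoC (- INR m)) ->
  ((c + INR n) * (INR (S n) * hyp2F1_coef a b c (S n)) =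
   (a + INR n) * (b + INR n) * hyp2F1_coef a b c n)%C.
Proof.
intros Hc. unfold hyp2F1_coef. rewrite fact_simpl, mult_INR, RtoC_mult.
simpl pochhammer.
field. repeat split.
- apply RtoC_neq_0, INR_fact_neq_0.
- now apply pochhammer_neq_0.
- apply RtoC_neq_0, not_0_INR. discriminate.
- now apply Cplus_INR_neq_0.
Qed.

Lemma bounded_of_eventually_decreasing (N : nat) : forall x : nat -> R,
  (forall n, (N <= n)%nat -> x (S n) <= x n) -> exists M, forall n, x n <= M.
Proof.
induction N as [|N IH]; intros x Hx.
- exists (x 0%nat). induction n as [|n IHn]; [lra|].
  eapply Rle_trans; [apply Hx; lia|exact IHn].
- destruct (IH (fun n => x (S n))) as [M HM].
  { intros n Hn. apply Hx. lia. }
  exists (Rmax (x 0%nat) M). intros [|n]; [apply Rmax_l|].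
  eapply Rle_trans; [apply HM|apply Rmax_r].
Qed.

(** The ratio test, in a form that tolerates vanishing coefficients (they occur
    when [a] or [b] is a nonpositive integer): [|k n| rho^n] eventually
    decreases. *)
Lemma hyp2F1_coef_radius (a b c : C) :
  (forall m : nat, c <> RtoC (- INR m)) -> radius_ge_1 (hyp2F1_coef a b c).
Proof.
intros Hc rho [[Hr| <-] Hr1].
2: { exists (Cmod (hyp2F1_coef a b c 0)). intros [|n]; simpl; [lra|].
     rewrite Rmult_0_l, Rmult_0_r. apply Cmod_ge_0. }
set (A := Cmod a). set (B := Cmod b). set (G := Cmod c).
assert (HA : 0 <= A) by apply Cmod_ge_0.
assert (HB : 0 <= B) by apply Cmod_ge_0.
assert (HG : 0 <= G) by apply Cmod_ge_0.
(* For n > T, the gap (1 - rho) n^2 between the leading terms absorbs the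
   lower order terms of (A + n) (B + n) rho <= (n - G) (n + 1). *)
set (T := (A + B + A * B + 2 * G) / (1 - rho)).
assert (HT : (A + B + A * B + 2 * G) = T * (1 - rho)) by (unfold T; field; lra).
destruct (INR_unbounded (T + G + 1)) as [N HN].
apply (bounded_of_eventually_decreasing N).
intros n Hn.
assert (HnT : T + G + 1 < INR n) by (apply le_INR in Hn; lra).
assert (HT0 : 0 <= T).
{ unfold T. apply Rdiv_le_0_compat; [|lra]. assert (0 <= A * B) by now apply Rmult_le_pos. lra. }
set (x := INR n) in *.
assert (Hcn : x - G <= Cmod (c + x)%C).
{ assert (Cmod (x) <= Cmod (c + x)%C + Cmod c).
  { replace (RtoC (x)) with ((c + x) + - c)%C at 1 by ring.
    eapply Rle_trans; [apply Cmod_triangle|]. rewrite Cmod_opp. lra. }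
  rewrite Cmod_R, Rabs_pos_eq in H by apply pos_INR. unfold G. lra. }
assert (Han : Cmod (a + x)%C <= A + x).
{ eapply Rle_trans; [apply Cmod_triangle|]. rewrite Cmod_R, Rabs_pos_eq by apply pos_INR. unfold A. lra. }
assert (Hbn : Cmod (b + x)%C <= B + x).
{ eapply Rle_trans; [apply Cmod_triangle|]. rewrite Cmod_R, Rabs_pos_eq by apply pos_INR. unfold B. lra. }
pose proof (f_equal Cmod (hyp2F1_coef_S a b c n Hc)) as E.
rewrite !Cmod_mult, Cmod_R, (Rabs_pos_eq (INR (S n))), S_INR in E by apply pos_INR.
fold x in E.
set (k1 := Cmod (hyp2F1_coef a b c (S n))) in *.
set (k0 := Cmod (hyp2F1_coef a b c n)) in *.
assert (Hk1 : 0 <= k1) by apply Cmod_ge_0.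
assert (Hk0 : 0 <= k0) by apply Cmod_ge_0.
assert (E1 : (x - G) * ((x + 1) * k1) <= (A + x) * (B + x) * k0).
{ apply Rle_trans with (Cmod (c + x)%C * ((x + 1) * k1)).
  - apply Rmult_le_compat_r; [apply Rmult_le_pos; lra|exact Hcn].
  - rewrite E. apply Rmult_le_compat_r; [exact Hk0|].
    apply Rmult_le_compat; auto using Cmod_ge_0. }
assert (E2 : rho * ((A + x) * (B + x)) <= (x - G) * (x + 1)).
{ assert ((A + x) * (B + x) * rho <= (x * x + (A + B + A * B) * x) * rho).
  { apply Rmult_le_compat_r; [lra|]. assert (0 <= A * B) by now apply Rmult_le_pos. nra. }
  assert (0 <= (A + B + A * B) * x * (1 - rho)).
  { assert (0 <= A * B) by now apply Rmult_le_pos. repeat apply Rmult_le_pos; lra. }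
  assert (T * (1 - rho) * x <= x * (1 - rho) * x).
  { apply Rmult_le_compat_r; [lra|]. apply Rmult_le_compat_r; lra. }
  assert (0 <= G * x) by (apply Rmult_le_pos; lra).
  assert (G <= G * x) by (rewrite <- (Rmult_1_r G) at 1; apply Rmult_le_compat_l; lra).
  nra. }
assert (Hx : 0 < (x - G) * (x + 1)) by (apply Rmult_lt_0_compat; lra).
assert (E3 : k1 * rho <= k0).
{ apply Rmult_le_reg_l with ((x - G) * (x + 1)); [exact Hx|].
  apply Rle_trans with (rho * ((A + x) * (B + x)) * k0).
  - replace ((x - G) * (x + 1) * (k1 * rho)) with (rho * ((x - G) * ((x + 1) * k1))) by ring.
    rewrite Rmult_assoc. apply Rmult_le_compat_l; lra.
  - apply Rmult_le_compat_r; assumption. }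
simpl pow. replace (k1 * (rho * rho ^ n)) with (k1 * rho * rho ^ n) by ring.
apply Rmult_le_compat_r; [apply pow_le; lra|exact E3].
Qed.

Lemma PS_euler (k : nat -> C) (z : C) : radius_ge_1 k -> Cmod z < 1 ->
  (z * PS (PS_deriv k) z)%C = PS (theta k) z.
Proof.
intros Hk Hz. rewrite (PS_incr_1 (theta k)) by (try apply radius_ge_1_theta; assumption).
unfold theta, PS_deriv. simpl (INR 0). ring.
Qed.

(** Comparing coefficients of [z^(n+1)], this is the recurrence
    [hyp2F1_coef_S]. *)
Lemma hyp2F1_ode (a b c z : C) :
  (forall m : nat, c <> RtoC (- INR m)) -> Cmod z < 1 ->
  let k := hyp2F1_coef a b c in
  let f0 := PS k z in
  let f1 := PS (theta k) z in
  let f2 := PS (theta (theta k)) z in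
  (f2 + (c - 1) * f1 = z * (f2 + (a + b) * f1 + a * b * f0))%C.
Proof.
intros Hc Hz k f0 f1 f2.
assert (R0 : radius_ge_1 k) by now apply hyp2F1_coef_radius.
assert (R1 : radius_ge_1 (theta k)) by now apply radius_ge_1_theta.
assert (R2 : radius_ge_1 (theta (theta k))) by now apply radius_ge_1_theta.
assert (R1' := radius_ge_1_scal (c - 1)%C _ R1).
assert (R1'' := radius_ge_1_scal (a + b)%C _ R1).
assert (R0' := radius_ge_1_scal (a * b)%C _ R0).
assert (R2' := radius_ge_1_plus _ _ R2 R1').
assert (R2'' := radius_ge_1_plus _ _ R2 R1'').
unfold f2, f1, f0.
rewrite <- (PS_scal (c - 1)%C), <- (PS_scal (a + b)%C), <- (PS_scal (a * b)%C) by assumption.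
rewrite <- (PS_plus _ _ z R2 R1' Hz), <- (PS_plus _ _ z R2 R1'' Hz), <- (PS_plus _ _ z R2'' R0' Hz).
rewrite (PS_incr_1 _ z R2' Hz). unfold theta. simpl (INR 0).
replace (0%R * (0%R * k 0%nat) + (c - 1) * (0%R * k 0%nat))%C with (RtoC 0) by ring.
rewrite Cplus_0_l. f_equal. apply C_series_ext. intros n. f_equal.
replace (INR n * (INR n * k n) + (a + b) * (INR n * k n) + a * b * k n)%C
  with ((a + INR n) * (b + INR n) * k n)%C by ring.
unfold k. rewrite <- hyp2F1_coef_S by exact Hc.
rewrite S_INR, RtoC_plus. ring.
Qed.

(** * The first point where the order condition fails *)

Lemma derivative_ge_0_of_one_sided_min (g : R -> R) (l del : R) :
  is_derive g 0 l -> g 0 = 0 -> 0 < del ->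
  (forall s, 0 < s < del -> 0 <= g s) -> 0 <= l.
Proof.
intros Hg H0 Hdel Hpos. apply Rnot_lt_le. intros Hl.
apply is_derive_Reals in Hg. destruct (Hg (- l) ltac:(lra)) as [d Hd].
pose proof (cond_pos d). pose proof (Rmin_pos d del). pose proof (Rmin_l d del). pose proof (Rmin_r d del).
set (s := Rmin d del / 2).
assert (Hs : 0 < s /\ s < d /\ s < del) by (unfold s; lra).
specialize (Hpos s ltac:(lra)).
specialize (Hd s ltac:(lra) ltac:(apply Rabs_def1; lra)).
rewrite Rplus_0_l, H0, Rminus_0_r in Hd. apply Rabs_def2 in Hd.
assert (0 <= g s / s) by (apply Rdiv_le_0_compat; lra). lra.
Qed.

Definition order_form (beta : R) (k : nat -> C) (z : C) : R :=
  Re (Cconj (PS k z) * (PS (theta k) z + beta * PS k z))%C.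

(** For [f = PS k], up to sign, [theta f / (2 beta f + theta f)] is the Cayley transform of
    [1 + theta f / (beta f)], which maps the half plane [Re w > 0] onto the unit
    disk. These are the coefficients of its denominator. *)
Definition cayley_denominator (beta : R) (k : nat -> C) (n : nat) : C :=
  ((2 * beta)%R * k n + theta k n)%C.

Section FirstViolation.

Variables (k : nat -> C) (beta : R).
Hypotheses (Hk : radius_ge_1 k) (Hk0 : k 0%nat = RtoC 1) (Hbeta : 0 < beta <= 1).

Local Notation P := (order_form beta k).
Local Notation k1 := (theta k).
Local Notation k2 := (theta (theta k)).
Local Notation kpsi := (cayley_denominator beta k).

Let Hk1 : radius_ge_1 k1 := radius_ge_1_theta k Hk.
Let Hk2 : radius_ge_1 k2 := radius_ge_1_theta k1 Hk1.
Let Hkpsi : radius_ge_1 kpsi := radius_ge_1_plus _ _ (radius_ge_1_scal _ k Hk) Hk1.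

Lemma PS_cayley_denominator (z : C) : Cmod z < 1 -> PS kpsi z = ((2 * beta)%R * PS k z + PS k1 z)%C.
Proof.
intros Hz. rewrite <- PS_scal by assumption.
apply PS_plus; [now apply radius_ge_1_scal|exact Hk1|exact Hz].
Qed.

Lemma PS_cayley_denominator_euler (z : C) : Cmod z < 1 ->
  (z * PS (PS_deriv kpsi) z)%C = ((2 * beta)%R * PS k1 z + PS k2 z)%C.
Proof.
intros Hz. rewrite PS_euler by assumption.
rewrite <- PS_scal by assumption.
rewrite <- PS_plus; [|now apply radius_ge_1_scal|exact Hk2|exact Hz].
apply C_series_ext. intros n. f_equal. unfold cayley_denominator, theta. ring.
Qed.

(** Positivity of [order_form] is thus the same as the Cayley transform having
    modulus less than 1. *)
Lemma Cmod2_cayley_gap (z : C) : Cmod z < 1 ->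
  Cmod (PS kpsi z) ^ 2 - Cmod (PS k1 z) ^ 2 = 4 * beta * P z.
Proof.
intros Hz. rewrite PS_cayley_denominator by exact Hz. unfold order_form. rewrite !Cmod2_alt.
generalize (PS k z) (PS k1 z). intros x y. unfold Re, Im. simpl. ring.
Qed.

Lemma PS_neq_0_of_order_form_pos (z : C) : 0 < P z -> PS k z <> RtoC 0.
Proof.
intros HP E. unfold order_form in HP. rewrite E in HP. revert HP. unfold Re. simpl. lra.
Qed.

Lemma order_form_continuous (z : C) : Cmod z < 1 -> continuous P z.
Proof.
intros Hz.
assert (K : forall l, radius_ge_1 l -> continuous (PS l) z).
{ intros l Hl. exact (C_is_derive_continuous _ _ _ (is_derive_PS l z Hl Hz)). }
assert (K1 := continuous_Cmod2 _ _ (K kpsi Hkpsi)).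
assert (K2 := continuous_Cmod2 _ _ (K k1 Hk1)).
assert (K3 : continuous (fun y => scal (/ (4 * beta)) (minus (Cmod (PS kpsi y) ^ 2) (Cmod (PS k1 y) ^ 2))) z).
{ apply @continuous_scal_r. apply @continuous_minus; assumption. }
apply (continuous_ext_loc _ (fun y => scal (/ (4 * beta)) (minus (Cmod (PS kpsi y) ^ 2) (Cmod (PS k1 y) ^ 2)))).
2: exact K3.
assert (Hloc : locally z (fun y => -1 < - Cmod y ^ 2)).
{ apply locally_lt_of_continuous.
  - apply @continuous_opp. apply (continuous_Cmod2 (fun y => y)), continuous_id.
  - pose proof (Cmod_ge_0 z). nra. }
revert Hloc. apply filter_imp. intros y Hy.
assert (Hy1 : Cmod y < 1) by (pose proof (Cmod_ge_0 y); nra).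
change (/ (4 * beta) * (Cmod (PS kpsi y) ^ 2 - Cmod (PS k1 y) ^ 2) = P y).
rewrite Cmod2_cayley_gap by exact Hy1. field. lra.
Qed.

Lemma PS_0 (l : nat -> C) : radius_ge_1 l -> PS l 0 = l 0%nat.
Proof. intros Hl. rewrite PS_incr_1; [ring|exact Hl|rewrite Cmod_0; lra]. Qed.

Lemma order_form_0 : P 0 = beta.
Proof.
unfold order_form. rewrite !PS_0 by assumption. unfold theta. rewrite Hk0.
unfold Re. simpl. ring.
Qed.

Lemma first_nonpositive_point (z1 : C) : Cmod z1 < 1 -> P z1 <= 0 ->
  exists z0, 0 < Cmod z0 < 1 /\ P z0 <= 0 /\ forall z, Cmod z < Cmod z0 -> 0 < P z.
Proof.
intros Hz1 HP1.
destruct (compact_attains_max (fun z => Cmod z <= Cmod z1 /\ P z <= 0)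
  (fun z => - Cmod z ^ 2) (Cmod z1)) as [z0 [[Hz0 HP0] Hmin]].
- exists z1. split; [lra|exact HP1].
- tauto.
- intros z Hz. destruct (Rlt_le_dec (Cmod z1) (Cmod z)) as [H|H].
  + apply open_Cmod_gt in H. revert H. apply filter_imp. intros y Hy [Hy' _]. lra.
  + assert (HP : 0 < P z) by (apply Rnot_le_lt; tauto).
    apply (locally_lt_of_continuous P z 0) in HP; [|apply order_form_continuous; lra].
    revert HP. apply filter_imp. intros y Hy [_ Hy']. lra.
- intros z _. apply @continuous_opp. apply (continuous_Cmod2 (fun y => y)), continuous_id.
- exists z0. split; [split|split; [exact HP0|]].
  + apply Cmod_gt_0. intros E. rewrite E, order_form_0 in HP0. lra.
  + lra.
  + intros z Hz. apply Rnot_le_lt. intros HPz.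
    specialize (Hmin z ltac:(lra)). pose proof (Cmod_ge_0 z). nra.
Qed.

Variable z0 : C.
Hypotheses (Hz0 : 0 < Cmod z0 < 1) (HP0 : P z0 <= 0)
  (HPin : forall z, Cmod z < Cmod z0 -> 0 < P z).

(** The derivative of [|z f|^2] along the radius is at least [order_form] up to a
    positive factor, as [beta <= 1]. So [|z f|] increases up to [z0] and [f] does
    not vanish there. *)
Lemma PS_neq_0_at_first_violation : PS k z0 <> RtoC 0.
Proof.
set (u := fun z => (z * PS k z)%C).
set (u' := fun z => (PS k z + PS k1 z)%C).
assert (Hu : forall z, Cmod z < 1 -> is_derive u z (u' z)).
{ intros z Hz. unfold u'. rewrite <- PS_euler by assumption.
  replace (PS k z + z * PS (PS_deriv k) z)%C with (1 * PS k z + z * PS (PS_deriv k) z)%C by ring.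
  apply (C_is_derive_mult (fun y => y) (PS k)); [apply C_is_derive_id|now apply is_derive_PS]. }
assert (Ht : forall t : R, 0 <= t <= 1 -> Cmod (0 + t * z0)%C = t * Cmod z0).
{ intros t Ht. rewrite Cplus_0_l, Cmod_mult, Cmod_R, Rabs_pos_eq; lra. }
destruct (MVT_cor2 (fun t : R => Cmod (u (0 + t * z0)%C) ^ 2)
  (fun t : R => 2 * Re (Cconj (u (0 + t * z0)) * (z0 * u' (0 + t * z0)))%C) (1 / 2) 1 ltac:(lra))
  as [t [E Ht01]].
{ intros t Ht1. apply is_derive_Reals. apply is_derive_Cmod2_line, Hu. rewrite Ht by lra. nra. }
assert (Hin : Cmod (0 + t * z0)%C < Cmod z0) by (rewrite Ht by lra; nra).
set (y := (0 + t * z0)%C) in *.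
assert (Hy0 : 0 < t * Re (Cconj (u y) * (z0 * u' y))%C).
{ replace (t * Re (Cconj (u y) * (z0 * u' y))%C) with
    (Cmod y ^ 2 * (P y + (1 - beta) * Cmod (PS k y) ^ 2)).
  - pose proof (HPin y Hin). pose proof (pow2_ge_0 (Cmod (PS k y))).
    assert (0 < Cmod y) by (unfold y; rewrite Ht by lra; apply Rmult_lt_0_compat; lra).
    apply Rmult_lt_0_compat; [apply pow_lt; assumption|].
    assert (0 <= (1 - beta) * Cmod (PS k y) ^ 2) by (apply Rmult_le_pos; lra). lra.
  - replace (t * Re (Cconj (u y) * (z0 * u' y))%C) with (Re (Cconj (u y) * (y * u' y))%C).
    + unfold u, u', order_form. rewrite !Cmod2_alt. generalize (PS k y) (PS k1 y) y. intros a b c.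
      unfold Re, Im. simpl. ring.
    + unfold y at 2. rewrite Cplus_0_l. generalize (Cconj (u y)) (u' y). intros a b.
      unfold Re. simpl. ring. }
assert (Hhalf : Cmod (0 + (1 / 2)%R * z0)%C < Cmod z0) by (rewrite Ht by lra; lra).
assert (Hu2 : u (0 + (1 / 2)%R * z0)%C <> RtoC 0).
{ apply Cmult_neq_0; [|apply PS_neq_0_of_order_form_pos, HPin; exact Hhalf].
  intros E0. apply (f_equal Cmod) in E0. rewrite Ht, Cmod_0 in E0 by lra. lra. }
apply Cmod_gt_0 in Hu2.
replace (0 + 1%R * z0)%C with z0 in E by ring.
intros E0. unfold u at 1 in E. rewrite E0, Cmult_0_r, Cmod_0 in E.
assert (0 < Re (Cconj (u y) * (z0 * u' y))%C) by nra.
nra.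
Qed.

Lemma order_form_eq_0_at_first_violation : P z0 = 0.
Proof.
apply Rle_antisym; [exact HP0|]. apply Rnot_lt_le. intros Hneg.
assert (K : locally z0 (fun y => 0 < - P y)).
{ apply (locally_lt_of_continuous (fun y => - P y)); [|lra].
  apply @continuous_opp. apply order_form_continuous. lra. }
destruct K as [d Hd]. pose proof (cond_pos d).
set (s := Rmin (d / 2) (1 / 2)).
assert (Hs : 0 < s /\ s <= d / 2 /\ s <= 1 / 2).
{ unfold s. pose proof (Rmin_l (d / 2) (1 / 2)). pose proof (Rmin_r (d / 2) (1 / 2)).
  pose proof (Rmin_pos (d / 2) (1 / 2)). lra. }
assert (Hy : Cmod ((1 - s)%R * z0)%C < Cmod z0).
{ rewrite Cmod_mult, Cmod_R, Rabs_pos_eq by lra. nra. }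
specialize (Hd ((1 - s)%R * z0)%C). specialize (HPin _ Hy).
assert (B : Cmod ((1 - s)%R * z0 - z0)%C <= d / 2).
{ replace ((1 - s)%R * z0 - z0)%C with ((- s)%R * z0)%C by (rewrite RtoC_minus, RtoC_opp; ring).
  rewrite Cmod_mult, Cmod_R, Rabs_Ropp, Rabs_pos_eq by lra. nra. }
apply Cmod_Re_Im_le in B. destruct B as [B1 B2].
enough (0 < - P ((1 - s)%R * z0)%C) by lra.
apply Hd. split.
- change (Rabs (Re ((1 - s)%R * z0 - z0)%C) < d). lra.
- change (Rabs (Im ((1 - s)%R * z0 - z0)%C) < d). lra.
Qed.

(** Schwarz's lemma for the Cayley transform [g], with [g z / z] written as a
    quotient without singularity at the origin: [z f' = theta f]. The maximum
    principle is applied on radii [rho < |z0|], since the denominator may vanish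
    on the limiting circle. *)
Lemma schwarz_bound_before_first_violation (z : C) : Cmod z < Cmod z0 ->
  Cmod z0 * Cmod (PS (PS_deriv k) z) <= Cmod (PS kpsi z).
Proof.
intros Hz.
set (phi := PS (PS_deriv k)). set (phi' := PS (PS_deriv (PS_deriv k))).
set (psi := PS kpsi). set (psi' := PS (PS_deriv kpsi)).
assert (Hlt : forall y, Cmod y < Cmod z0 -> Cmod (PS k1 y) < Cmod (psi y)).
{ intros y Hy. pose proof (Cmod2_cayley_gap y ltac:(lra)) as E. fold psi in E.
  pose proof (HPin y Hy). pose proof (Cmod_ge_0 (psi y)). pose proof (Cmod_ge_0 (PS k1 y)).
  assert (0 < 4 * beta * P y) by (apply Rmult_lt_0_compat; lra).
  apply Rnot_le_lt. intros Hn. nra. }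
assert (Hpsi0 : forall y, Cmod y < Cmod z0 -> psi y <> RtoC 0).
{ intros y Hy E. specialize (Hlt y Hy). rewrite E, Cmod_0 in Hlt.
  pose proof (Cmod_ge_0 (PS k1 y)). lra. }
assert (Dphi : forall y, Cmod y < Cmod z0 -> is_derive phi y (phi' y)).
{ intros y Hy. apply is_derive_PS; [now apply radius_ge_1_deriv|lra]. }
assert (Dpsi : forall y, Cmod y < Cmod z0 -> is_derive psi y (psi' y)).
{ intros y Hy. apply is_derive_PS; [exact Hkpsi|lra]. }
assert (Dphi' : forall y, Cmod y < Cmod z0 -> is_derive phi' y (PS (PS_deriv (PS_deriv (PS_deriv k))) y)).
{ intros y Hy. apply is_derive_PS; [now apply radius_ge_1_deriv, radius_ge_1_deriv|lra]. }
assert (Dpsi' : forall y, Cmod y < Cmod z0 -> is_derive psi' y (PS (PS_deriv (PS_deriv kpsi)) y)).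
{ intros y Hy. apply is_derive_PS; [now apply radius_ge_1_deriv|lra]. }
assert (Hrho : forall rho, Cmod z < rho < Cmod z0 -> rho * Cmod (phi z) <= Cmod (psi z)).
{ intros rho Hrho. pose proof (Cmod_ge_0 z).
  assert (Hq : Cmod (phi z / psi z)%C <= / rho).
  { apply (maximum_modulus (fun y => phi y / psi y)%C
      (fun y => (phi' y * psi y - phi y * psi' y) / (psi y * psi y))%C (Cmod z0) rho); [lra| | | |lra].
    - intros y Hy. apply C_is_derive_div; auto.
    - intros y Hy. eexists. apply C_is_derive_div.
      + apply C_is_derive_minus; apply C_is_derive_mult; eauto.
      + apply C_is_derive_mult; eauto.
      + apply Cmult_neq_0; auto.
    - intros y Hy. assert (Hy' : Cmod y < Cmod z0) by lra.
      specialize (Hlt y Hy'). rewrite <- PS_euler in Hlt by (assumption || lra).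
      rewrite Cmod_mult, Hy in Hlt. fold phi in Hlt.
      assert (0 < Cmod (psi y)) by (apply Cmod_gt_0; auto).
      unfold Cdiv. rewrite Cmod_mult, Cmod_inv by auto.
      apply Rmult_le_reg_r with (Cmod (psi y)); [assumption|].
      rewrite Rmult_assoc, Rinv_l, Rmult_1_r by lra.
      apply Rmult_le_reg_l with rho; [lra|]. rewrite <- Rmult_assoc, Rinv_r by lra. lra. }
  assert (Hp : 0 < Cmod (psi z)) by (apply Cmod_gt_0; auto).
  unfold Cdiv in Hq. rewrite Cmod_mult, Cmod_inv in Hq by auto.
  apply Rmult_le_reg_r with (/ rho * / Cmod (psi z)).
  { apply Rmult_lt_0_compat; apply Rinv_0_lt_compat; lra. }
  replace (rho * Cmod (phi z) * (/ rho * / Cmod (psi z))) with (Cmod (phi z) * / Cmod (psi z)) by (field; lra).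
  replace (Cmod (psi z) * (/ rho * / Cmod (psi z))) with (/ rho) by (field; lra). exact Hq. }
apply Rnot_lt_le. intros Hn.
assert (Hphi : 0 < Cmod (phi z)).
{ pose proof (Cmod_ge_0 (psi z)). pose proof (Cmod_ge_0 (phi z)).
  destruct (Req_dec (Cmod (phi z)) 0) as [E|E]; [rewrite E in Hn|]; lra. }
set (m := Rmax (Cmod z) (Cmod (psi z) / Cmod (phi z))).
assert (Hm : m < Cmod z0).
{ apply Rmax_lub_lt; [exact Hz|]. apply Rmult_lt_reg_r with (Cmod (phi z)); [exact Hphi|].
  unfold Rdiv. rewrite Rmult_assoc, Rinv_l; lra. }
assert (Hm1 : Cmod z <= m) by apply Rmax_l.
assert (Hm2 : Cmod (psi z) / Cmod (phi z) <= m) by apply Rmax_r.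
specialize (Hrho ((m + Cmod z0) / 2) ltac:(lra)).
apply (Rmult_le_compat_r (Cmod (phi z))) in Hm2; [|lra].
unfold Rdiv in Hm2. rewrite Rmult_assoc, Rinv_l, Rmult_1_r in Hm2 by lra.
nra.
Qed.

(** By the Schwarz bound,
    [E z = |z|^2 |2 beta f + theta f|^2 - |z0|^2 |theta f|^2] is nonnegative for
    [|z| < |z0|], and it vanishes at [z0]. Its derivative at [z0] in each inward
    direction [z0 (-1 + i sigma)] is therefore nonnegative. Up to a positive
    factor, this derivative is
    [- (beta^2 + (Im q)^2) - 2 beta (Re kappa + sigma Im kappa)], so that letting
    [sigma] run through the reals gives both claims on [kappa = theta q]. *)
Lemma jack_at_first_violation :
  let q := (PS k1 z0 / PS k z0)%C in
  let kappa := (PS k2 z0 / PS k z0 - q * q)%C in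
  Re q = - beta /\ Im kappa = 0 /\ 2 * beta * Re kappa <= - (beta ^ 2 + Im q ^ 2).
Proof.
intros q kappa.
pose proof PS_neq_0_at_first_violation as Hf0.
pose proof order_form_eq_0_at_first_violation as HP.
set (f0 := PS k z0) in *.
assert (Hf0' : 0 < Cmod f0 ^ 2) by (apply pow_lt, Cmod_gt_0; exact Hf0).
assert (Hf1 : PS k1 z0 = (q * f0)%C) by (unfold q; field; exact Hf0).
assert (Hf2 : PS k2 z0 = ((kappa + q * q) * f0)%C) by (unfold kappa; field; exact Hf0).
assert (Hq : Re q = - beta).
{ unfold order_form in HP. fold f0 in HP. rewrite Hf1 in HP.
  assert (Cmod f0 ^ 2 * (Re q + beta) = 0).
  { rewrite <- HP, Cmod2_alt. clearbody f0 q. unfold Re, Im. simpl. ring. }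
  apply Rmult_integral in H. lra. }
set (r := Cmod z0) in *.
set (E := fun z : C => Cmod z ^ 2 * Cmod (PS kpsi z) ^ 2 - r ^ 2 * Cmod (PS k1 z) ^ 2).
assert (HE : forall z, Cmod z < r -> 0 <= E z).
{ intros z Hz. unfold E. rewrite <- PS_euler by (assumption || lra). rewrite Cmod_mult.
  pose proof (schwarz_bound_before_first_violation z Hz) as Hs. fold r in Hs.
  pose proof (Cmod_ge_0 (PS (PS_deriv k) z)).
  assert (Hs2 : (r * Cmod (PS (PS_deriv k) z)) ^ 2 <= Cmod (PS kpsi z) ^ 2).
  { apply pow_incr. split; [apply Rmult_le_pos; lra|exact Hs]. }
  apply (Rmult_le_compat_l (Cmod z ^ 2)) in Hs2; [|apply pow2_ge_0]. lra. }
assert (HE0 : E z0 = 0).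
{ unfold E. fold r. pose proof (Cmod2_cayley_gap z0 ltac:(unfold r in *; lra)) as Ha. rewrite HP in Ha.
  replace (Cmod (PS kpsi z0) ^ 2) with (Cmod (PS k1 z0) ^ 2) by lra. ring. }
assert (Hdir : forall sigma : R,
  0 <= - (beta ^ 2 + Im q ^ 2) - 2 * beta * Re kappa - 2 * beta * sigma * Im kappa).
{ intros sigma. set (w := (-1, sigma) : C).
  set (v := (z0 * w)%C).
  assert (E0 : (z0 + 0%R * v)%C = z0) by ring.
  assert (D1 : is_derive (fun s : R => Cmod (z0 + s * v)%C ^ 2) 0 (2 * Re (Cconj z0 * (v * 1))%C)).
  { eapply is_derive_eq; [apply (is_derive_Cmod2_line (fun y => y)), C_is_derive_id|reflexivity|].
    rewrite E0. reflexivity. }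
  assert (D2 : is_derive (fun s : R => Cmod (PS kpsi (z0 + s * v)%C) ^ 2) 0
    (2 * Re (Cconj (PS kpsi z0) * (v * PS (PS_deriv kpsi) z0))%C)).
  { eapply is_derive_eq; [apply is_derive_Cmod2_line|reflexivity|].
    - rewrite E0. apply is_derive_PS; [exact Hkpsi|unfold r in *; lra].
    - rewrite E0. reflexivity. }
  assert (D3 : is_derive (fun s : R => Cmod (PS k1 (z0 + s * v)%C) ^ 2) 0
    (2 * Re (Cconj (PS k1 z0) * (v * PS (PS_deriv k1) z0))%C)).
  { eapply is_derive_eq; [apply is_derive_Cmod2_line|reflexivity|].
    - rewrite E0. apply is_derive_PS; [exact Hk1|unfold r in *; lra].
    - rewrite E0. reflexivity. }
  assert (DC : is_derive (fun _ : R => - r ^ 2) 0 0) by apply @is_derive_const.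
  pose proof (is_derive_dot _ _ _ _ 0 _ _ _ _ D1 DC D2 D3) as D.
  assert (Hl := derivative_ge_0_of_one_sided_min _ _ (1 / (1 + sigma ^ 2)) D).
  cbv beta in Hl. rewrite E0 in Hl. fold r in Hl.
  pose proof (pow2_ge_0 sigma) as Hsig.
  specialize (Hl ltac:(rewrite <- HE0; unfold E; fold r; ring) ltac:(apply Rdiv_lt_0_compat; lra)).
  assert (Hmin : forall s, 0 < s < 1 / (1 + sigma ^ 2) ->
    0 <= Cmod (z0 + s * v)%C ^ 2 * Cmod (PS kpsi (z0 + s * v)%C) ^ 2
       + - r ^ 2 * Cmod (PS k1 (z0 + s * v)%C) ^ 2).
  { intros s Hs.
    assert (Hs1 : s * (1 + sigma ^ 2) < 1).
    { apply Rmult_lt_reg_r with (/ (1 + sigma ^ 2)); [apply Rinv_0_lt_compat; lra|].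
      rewrite Rmult_assoc, Rinv_r by lra. unfold Rdiv in Hs. lra. }
    (* |1 + s w|^2 = 1 - 2 s + s^2 (1 + sigma^2), whence the bound on s. *)
    enough (Hin : Cmod (z0 + s * v)%C < r) by (specialize (HE _ Hin); unfold E in HE; lra).
    assert (Hw : Cmod (1 + s * w)%C ^ 2 < 1).
    { rewrite Cmod2_alt. unfold w, Re, Im. simpl. nra. }
    unfold v. replace (z0 + s * (z0 * w))%C with (z0 * (1 + s * w))%C by ring.
    rewrite Cmod_mult. fold r. pose proof (Cmod_ge_0 (1 + s * w)%C).
    assert (Cmod (1 + s * w)%C < 1) by nra. nra. }
  specialize (Hl Hmin). clear D D1 D2 D3 Hmin.
  replace (v * PS (PS_deriv kpsi) z0)%C with (w * (z0 * PS (PS_deriv kpsi) z0))%C in Hl by (unfold v; ring).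
  replace (v * PS (PS_deriv k1) z0)%C with (w * (z0 * PS (PS_deriv k1) z0))%C in Hl by (unfold v; ring).
  rewrite PS_cayley_denominator_euler in Hl by (unfold r in *; lra).
  rewrite (PS_euler k1) in Hl by (assumption || unfold r in *; lra).
  rewrite PS_cayley_denominator in Hl by (unfold r in *; lra). fold f0 in Hl.
  rewrite Hf1, Hf2 in Hl.
  apply Rmult_le_reg_l with (2 * r ^ 2 * Cmod f0 ^ 2).
  { apply Rmult_lt_0_compat; [|exact Hf0']. apply Rmult_lt_0_compat; [lra|apply pow_lt; lra]. }
  rewrite Rmult_0_r. eapply Rle_trans; [exact Hl|]. right.
  replace (Re (Cconj z0 * (v * 1))%C) with (- r ^ 2).
  2: { unfold r, v, w. rewrite Cmod2_alt. unfold Re, Im. simpl. ring. }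
  clear Hl. rewrite !Cmod2_alt. clearbody kappa q f0 r.
  destruct q as [q1 q2]. unfold Re in Hq. simpl in Hq. subst q1.
  unfold w, Re, Im. simpl. ring. }
split; [exact Hq|].
assert (HIm : Im kappa = 0).
{ destruct (Req_dec (Im kappa) 0) as [H|H]; [exact H|]. exfalso.
  set (X := - (beta ^ 2 + Im q ^ 2) - 2 * beta * Re kappa) in *.
  (* This sigma makes the directional derivative equal to -1. *)
  specialize (Hdir ((X + 1) / (2 * beta * Im kappa))).
  replace (2 * beta * ((X + 1) / (2 * beta * Im kappa)) * Im kappa) with (X + 1) in Hdir
    by (field; split; lra). lra. }
split; [exact HIm|]. specialize (Hdir 0). lra.
Qed.

End FirstViolation.

(** * Excluding a boundary point *)

Lemma quadratic_form_nonneg (L M N x y : R) :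
  L >= 0 -> N >= 0 -> L * N - M ^ 2 >= 0 -> 0 <= L * x ^ 2 - 2 * M * x * y + N * y ^ 2.
Proof.
intros HL HN HD. pose proof (pow2_ge_0 x). pose proof (pow2_ge_0 y).
destruct HL as [HL|HL].
- apply Rmult_le_reg_l with L; [exact HL|]. rewrite Rmult_0_r.
  replace (L * (L * x ^ 2 - 2 * M * x * y + N * y ^ 2))
    with ((L * x - M * y) ^ 2 + (L * N - M ^ 2) * y ^ 2) by ring.
  pose proof (pow2_ge_0 (L * x - M * y)).
  assert (0 <= (L * N - M ^ 2) * y ^ 2) by (apply Rmult_le_pos; lra). lra.
- assert (HM : M = 0).
  { rewrite HL in HD. pose proof (pow2_ge_0 M). apply Rsqr_0_uniq. unfold Rsqr. lra. }
  rewrite HL, HM. assert (0 <= N * y ^ 2) by (apply Rmult_le_pos; lra). lra.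
Qed.

(** The terms of degree 4 and 3 in [t] cancel because [c - 1] and [a + b] differ
    by the real number [p]; [L], [M] and [N] are what remains. *)
Lemma boundary_form_identity (alpha : R) (a b c : C) (p t : R) :
  alpha < 1 -> RtoC p = (a + b + 1 - c)%C ->
  let beta := 1 - alpha in
  let q : C := (- beta, t) in
  let common := Re (a * b)%C / (1 - alpha) + p * (1 - 2 * alpha)
            - Cmod a ^ 2 - Cmod b ^ 2 + Cmod (c - 1)%C ^ 2 in
  let L := common - 4 * Im a * Im b in
  let M := Im (a * b * (Cconj a + Cconj b - 2 + 2 * alpha))%C / (1 - alpha) in
  let N := common - (2 * Re a - Cmod a ^ 2 / (1 - alpha))
              * (2 * Re b - Cmod b ^ 2 / (1 - alpha)) in
  Cmod (q * (q + c - 1))%C ^ 2 - Cmod ((q + a) * (q + b))%C ^ 2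
  + (beta ^ 2 + t ^ 2) / beta * (Re (a * b)%C - p * beta)
  = L * t ^ 2 - 2 * M * t * beta + N * beta ^ 2.
Proof.
intros Hal Hp beta q common L M N. unfold L, M, N, common, q, beta. clear L M N common q beta.
assert (Hc : c = (a + b + 1 - p)%C) by (rewrite Hp; ring). subst c. clear Hp.
rewrite !Cmod2_alt. destruct a as [a1 a2], b as [b1 b2].
unfold Re, Im. simpl. field. lra.
Qed.

(** [|kappa + A|^2 - |kappa + B|^2] is affine in the real number [kappa], with
    slope [- 2 Re (B - A) = - 2 (Re (ab) - p (1 - alpha)) < 0]. It is therefore
    least at the largest value allowed by Jack's lemma, where
    [boundary_form_identity] evaluates it. *)
Lemma no_boundary_point (alpha : R) (a b c z q kappa : C) (p L M N : R) :
  0 <= alpha < 1 ->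
  RtoC p = (a + b + 1 - c)%C ->
  Re (a * b)%C > p * (1 - alpha) ->
  L = Re (a * b)%C / (1 - alpha) + p * (1 - 2 * alpha)
      - Cmod a ^ 2 - Cmod b ^ 2 + Cmod (c - 1)%C ^ 2 - 4 * Im a * Im b ->
  M = Im (a * b * (Cconj a + Cconj b - 2 + 2 * alpha))%C / (1 - alpha) ->
  N = Re (a * b)%C / (1 - alpha) + p * (1 - 2 * alpha)
      - Cmod a ^ 2 - Cmod b ^ 2 + Cmod (c - 1)%C ^ 2
      - (2 * Re a - Cmod a ^ 2 / (1 - alpha)) * (2 * Re b - Cmod b ^ 2 / (1 - alpha)) ->
  L >= 0 -> N >= 0 -> L * N - M ^ 2 >= 0 ->
  Cmod z < 1 ->
  Re q = - (1 - alpha) -> Im kappa = 0 ->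
  2 * (1 - alpha) * Re kappa <= - ((1 - alpha) ^ 2 + Im q ^ 2) ->
  (kappa + q * (q + c - 1))%C <> (z * (kappa + (q + a) * (q + b)))%C.
Proof.
intros Hal Hp Hre HL HM HN HL0 HN0 HLN Hz Hq Him Hkap E.
destruct q as [q1 t], kappa as [K k2]. unfold Re, Im in Hq, Him, Hkap. simpl fst in *. simpl snd in *.
subst q1 k2. set (q := (- (1 - alpha), t) : C) in *.
pose proof (boundary_form_identity alpha a b c p t ltac:(lra) Hp) as HI.
cbv zeta in HI. fold q in HI. rewrite <- HL, <- HM, <- HN in HI.
pose proof (quadratic_form_nonneg L M N t (1 - alpha) HL0 HN0 HLN) as Hpos.
set (A := (q * (q + c - 1))%C) in *. set (B := ((q + a) * (q + b))%C) in *.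
assert (HBA : (B - A)%C = (p * q + a * b)%C) by (unfold A, B; rewrite Hp; ring).
assert (HReBA : Re B - Re A = Re (a * b)%C - p * (1 - alpha)).
{ apply (f_equal Re) in HBA. revert HBA. generalize A B (a * b)%C. intros x y w.
  unfold q, Re. simpl. lra. }
change ((K, 0) : C) with (RtoC K) in E.
assert (Hdiff : Cmod (K + A)%C ^ 2 - Cmod (K + B)%C ^ 2 =
   Cmod A ^ 2 - Cmod B ^ 2 - 2 * K * (Re B - Re A)).
{ rewrite !Cmod2_alt. clear. clearbody A B. unfold Re, Im. simpl. ring. }
assert (HK : ((1 - alpha) ^ 2 + t ^ 2) / (1 - alpha) <= - 2 * K).
{ apply Rmult_le_reg_r with (1 - alpha); [lra|].
  replace (((1 - alpha) ^ 2 + t ^ 2) / (1 - alpha) * (1 - alpha)) with ((1 - alpha) ^ 2 + t ^ 2) by (field; lra).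
  lra. }
assert (Hge : Cmod (K + B)%C ^ 2 <= Cmod (K + A)%C ^ 2).
{ apply (Rmult_le_compat_r (Re (a * b)%C - p * (1 - alpha))) in HK; [|lra].
  rewrite HReBA in Hdiff. lra. }
(* |kappa + A| = |z| |kappa + B| with |z| < 1, so both sides vanish. *)
apply (f_equal Cmod) in E as E'. rewrite Cmod_mult in E'.
rewrite E' in Hge. pose proof (Cmod_ge_0 z). pose proof (Cmod_ge_0 (K + B)%C).
assert (HB0 : Cmod (K + B)%C = 0).
{ destruct (Req_dec (Cmod (K + B)%C) 0) as [H1|H1]; [exact H1|]. exfalso.
  assert (0 < Cmod (K + B)%C ^ 2) by (apply pow_lt; lra).
  rewrite Rpow_mult_distr in Hge. assert (Cmod z ^ 2 < 1) by nra. nra. }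
rewrite HB0, Rmult_0_r in E'.
apply Cmod_eq_0 in HB0, E'.
assert (Re B - Re A = 0).
{ apply (f_equal Re) in HB0, E'. revert HB0 E'. generalize A B. intros x y. unfold Re. simpl. lra. }
lra.
Qed.

Theorem theorem2 (alpha : R) (a b c : C) (p L M N : R)
  (halpha : 0 <= alpha < 1)
  (hab : (a * b)%C <> RtoC 0)
  (hc : forall n : nat, c <> RtoC (- INR n))
  (hp : RtoC p = (a + b + 1 - c)%C)
  (hre : Re (a * b)%C > p * (1 - alpha))
  (hL : L = Re (a * b)%C / (1 - alpha) + p * (1 - 2 * alpha)
            - Cmod a ^ 2 - Cmod b ^ 2 + Cmod (c - 1)%C ^ 2
            - 4 * Im a * Im b)
  (hM : M = Im (a * b * (Cconj a + Cconj b - 2 + 2 * alpha))%C / (1 - alpha))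
  (hN : N = Re (a * b)%C / (1 - alpha) + p * (1 - 2 * alpha)
            - Cmod a ^ 2 - Cmod b ^ 2 + Cmod (c - 1)%C ^ 2
            - (2 * Re a - Cmod a ^ 2 / (1 - alpha))
              * (2 * Re b - Cmod b ^ 2 / (1 - alpha)))
  (hL0 : L >= 0)
  (hN0 : N >= 0)
  (hLNM : L * N - M ^ 2 >= 0) :
  starlike_of_order alpha (fun z : C => (z * hyp2F1 a b c z)%C).
Proof.
set (k := hyp2F1_coef a b c).
assert (Hk : radius_ge_1 k) by now apply hyp2F1_coef_radius.
assert (Hk0 : k 0%nat = RtoC 1).
{ unfold k, hyp2F1_coef. simpl. field. }
assert (HP : forall z, Cmod z < 1 -> 0 < order_form (1 - alpha) k z).
{ intros z1 Hz1. apply Rnot_le_lt. intros HP1.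
  assert (Hb : 0 < 1 - alpha <= 1) by lra.
  destruct (first_nonpositive_point k (1 - alpha) Hk Hk0 Hb z1 Hz1 HP1) as (z0 & Hz0 & HP0 & Hin).
  pose proof (jack_at_first_violation k (1 - alpha) Hk Hb z0 Hz0 HP0 Hin) as D.
  pose proof (PS_neq_0_at_first_violation k (1 - alpha) Hk Hb z0 Hz0 Hin) as Hf0.
  cbv zeta in D. destruct D as (D1 & D2 & D3).
  apply (no_boundary_point alpha a b c z0 _ _ p L M N halpha hp hre hL hM hN hL0 hN0 hLNM
    (proj2 Hz0) D1 D2 D3).
  pose proof (hyp2F1_ode a b c z0 hc (proj2 Hz0)) as Hode. cbv zeta in Hode. fold k in Hode.
  set (f0 := PS k z0) in *. set (f1 := PS (theta k) z0) in *.
  set (f2 := PS (theta (theta k)) z0) in *.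
  clearbody f0 f1 f2.
  replace (f2 / f0 - f1 / f0 * (f1 / f0) + f1 / f0 * (f1 / f0 + c - 1))%C
    with ((f2 + (c - 1) * f1) / f0)%C by (field; exact Hf0).
  rewrite Hode. field. exact Hf0. }
assert (Hne : forall z, Cmod z < 1 -> PS k z <> RtoC 0).
{ intros z Hz. exact (PS_neq_0_of_order_form_pos k (1 - alpha) z (HP z Hz)). }
assert (Hd : forall z, Cmod z < 1 ->
  is_derive (fun z : C => (z * hyp2F1 a b c z)%C) z (PS k z + PS (theta k) z)%C).
{ intros z Hz. rewrite <- PS_euler by assumption.
  replace (PS k z + z * PS (PS_deriv k) z)%C with (1 * PS k z + z * PS (PS_deriv k) z)%C by ring.
  apply (C_is_derive_mult (fun y => y) (PS k)); [apply C_is_derive_id|now apply is_derive_PS]. }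
assert (H0 : PS k 0 = RtoC 1) by now rewrite PS_0.
split; [|split; [|split; [|split]]].
- intros z Hz. eexists. exact (Hd z Hz).
- ring.
- apply is_C_derive_unique.
  replace (RtoC 1) with (PS k 0 + PS (theta k) 0)%C; [apply Hd; rewrite Cmod_0; lra|].
  rewrite H0. rewrite <- PS_euler by (assumption || rewrite Cmod_0; lra). ring.
- intros z Hz Hz0. apply Cmult_neq_0; [exact Hz0|]. exact (Hne z Hz).
- intros z Hz. unfold starlike_quotient. destruct (Ceq_dec z 0) as [Ez|Ez].
  + unfold Re. simpl. lra.
  + rewrite (is_C_derive_unique _ _ _ (Hd z Hz)). rewrite hyp2F1_PS. fold k.
    specialize (HP z Hz). specialize (Hne z Hz). unfold order_form in HP.
    replace (z * (PS k z + PS (theta k) z) / (z * PS k z))%C with (1 + PS (theta k) z / PS k z)%C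
      by (field; split; assumption).
    set (f0 := PS k z) in *. assert (Hf0 : 0 < Cmod f0 ^ 2) by (apply pow_lt, Cmod_gt_0; exact Hne).
    set (q := (PS (theta k) z / f0)%C).
    replace (PS (theta k) z) with (q * f0)%C in HP by (unfold q; field; exact Hne).
    clearbody f0 q.
    assert (HQ : 0 < Cmod f0 ^ 2 * (Re q + (1 - alpha))).
    { eapply Rlt_le_trans; [exact HP|]. right. rewrite Cmod2_alt. unfold Re, Im. simpl. ring. }
    assert (0 < Re q + (1 - alpha)).
    { apply Rmult_lt_reg_l with (Cmod f0 ^ 2); [exact Hf0|]. lra. }
    unfold Re in *. simpl. lra.
Qed.
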